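(* Let $(\phi,\xi,\eta)$ be an almost contact structure on an odd-dimensional smooth manifold $M$. Then $(\phi,\xi,\eta)$ is normal in the generalized sense, i.e. its associated generalized almost contact triple is normal, if and only if $(\phi,\xi,\eta)$ is an ordinary normal almost contact structure.
   Context: An almost contact structure $(\phi,\xi,\eta)$ on $M$ consists of a bundle morphism $\phi:TM\to TM$, a vector field $\xi$ and a 1-form $\eta$ with $\eta(\xi)=1$, $\phi(\xi)=0=\phi^*(\eta)$, $\phi^2(X)=-X+\eta(X)\xi$. It is normal in the ordinary sense if the almost complex structure on $M\times\mathbb{R}$ given by $X+f\partial_s\mapsto\phi X-f\xi+\eta(X)\partial_s$ is integrable ($s$ the coordinate on $\mathbb{R}$). $\mathbb{T}M=TM\oplus T^*M$ carries $\langle X+\alpha,Y+\beta\rangle=\frac12(\alpha(Y)+\beta(X))$ and the Dorfman bracket $[X+\alpha,Y+\beta]=[X,Y]+\mathcal{L}_X\beta-i_Yd\alpha$; $a:\mathbb{T}M\to TM$ is the projection. A generalized almost contact triple $(\Phi,\mathbf{e}_1,\mathbf{e}_2)$ consists of a base-fixing bundle morphism $\Phi:\mathbb{T}M\to\mathbb{T}M$ and $\mathbf{e}_1,\mathbf{e}_2\in\Gamma(\mathbb{T}M)$ with $\langle\mathbf{e}_1,\mathbf{e}_1\rangle=\langle\mathbf{e}_2,\mathbf{e}_2\rangle=0$, $\langle\mathbf{e}_1,\mathbf{e}_2\rangle=1/2$, $\Phi^*=-\Phi$, $\Phi(\mathbf{e}_1)=\Phi(\mathbf{e}_2)=0$,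 $\Phi^2(\mathbf{x})=-\mathbf{x}+2\langle\mathbf{x},\mathbf{e}_1\rangle\mathbf{e}_2+2\langle\mathbf{x},\mathbf{e}_2\rangle\mathbf{e}_1$. The triple associated to $(\phi,\xi,\eta)$ is $\mathbf{e}_1=\xi$, $\mathbf{e}_2=\eta$, $\Phi(X+\alpha)=\phi(X)-\phi^*(\alpha)$. Let $\mathcal{E}'(M)=\mathbb{T}M\oplus\mathrm{span}(\partial_t,dt)$. For $\mathbf{X}_i=\mathbf{x}_i+f_i\partial_t+g_idt$ ($\mathbf{x}_i\in\Gamma(\mathbb{T}M)$, $f_i,g_i\in C^\infty(M)$) put $\langle\mathbf{X}_1,\mathbf{X}_2\rangle=\langle\mathbf{x}_1,\mathbf{x}_2\rangle+\frac12(f_1g_2+f_2g_1)$ and $[\mathbf{X}_1,\mathbf{X}_2]=[\mathbf{x}_1,\mathbf{x}_2]+(a(\mathbf{x}_1)(f_2)-a(\mathbf{x}_2)(f_1))\partial_t+(a(\mathbf{x}_1)(g_2)-a(\mathbf{x}_2)(g_1))dt+g_2df_1+f_2dg_1$. Each triple $(\Phi,\mathbf{e}_1,\mathbf{e}_2)$ has a unique associated base-preserving bundle morphism $J:\mathcal{E}'(M)\to\mathcal{E}'(M)$ with $J^2=-\mathrm{Id}$, $J^*=-J$: $J(\partial_t)=\mathbf{e}_1$, $J(dt)=\mathbf{e}_2$, $J(\mathbf{e}_1)=-\partial_t$, $J(\mathbf{e}_2)=-dt$, and $J=\Phi$ on $\{\mathbf{e}_1,\mathbf{e}_2\}^\perp\subset\mathbb{T}M$.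 The triple is normal if $J$ is integrable: $[J\mathbf{X},J\mathbf{Y}]-[\mathbf{X},\mathbf{Y}]-J([J\mathbf{X},\mathbf{Y}]+[\mathbf{X},J\mathbf{Y}])=0$ for all sections $\mathbf{X},\mathbf{Y}$ of $\mathcal{E}'(M)$. *)

(* Defs.v *)
From HB Require Import structures.
From mathcomp Require Import all_boot all_order all_algebra.
From mathcomp Require Import all_classical all_reals all_analysis.

Set Implicit Arguments.
Unset Strict Implicit.
Unset Printing Implicit Defensive.

Import Order.TTheory GRing.Theory Num.Theory.
Import numFieldNormedType.Exports.

Local Open Scope classical_set_scope.
Local Open Scope ring_scope.

(* C^k on an open set U.  The spaces used below are all finite-dimensional,
   where it suffices to test the iterated differentials on fixed vectors. *)
Fixpoint Ck (R : realType) (V W : normedModType R) (k : nat) (U : set V)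
    (f : V -> W) : Prop :=
  match k with
  | 0 => forall x, U x -> {for x, continuous f}
  | k'.+1 => (forall x, U x -> differentiable f x) /\
             (forall v : V, Ck k' U (fun x => 'd f x v))
  end.

Definition smooth_on (R : realType) (V W : normedModType R) (U : set V)
    (f : V -> W) : Prop :=
  forall k : nat, Ck k U f.

(* An atlas on M modelled on E, indexed by the points of M: the chart indexed
   by c is [ch c] on [dom c], a neighbourhood of c, and [chV c] is its inverse.
   Every atlas can be indexed in this way, by choosing a chart around each
   point; this preferred chart is used to identify the tangent space at c
   with E.  The values of [ch c] off [dom c] and of [chV c] off [target c] are
   irrelevant. *)
Record atlas (R : realType) (E : normedModType R) (M : Type) := Atlas {
  dom : M -> set M;
  ch : M -> M -> E;
  chV : M -> E -> M
}.

Definition target (R : realType) (E : normedModType R) (M : Type)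
  (A : atlas E M) (c : M) : set E := ch A c @` dom A c.

Definition transition (R : realType) (E : normedModType R) (M : Type)
  (A : atlas E M) (c c' : M) : E -> E := fun y => ch A c' (chV A c y).

Record smooth_manifold (R : realType) (E : normedModType R)
    (M : topologicalType) (A : atlas E M) : Prop := SmoothManifold {
  mfd_hausdorff : hausdorff_space M;
  mfd_second_countable : @second_countable M;
  mfd_center : forall c, dom A c c;
  mfd_dom_open : forall c, open (dom A c);
  mfd_target_open : forall c, open (target A c);
  mfd_chK : forall c q, dom A c q -> chV A c (ch A c q) = q;
  mfd_ch_cont : forall c q, dom A c q -> {for q, continuous (ch A c)};
  mfd_chV_cont : forall c y, target A c y -> {for y, continuous (chV A c)};
  mfd_compat : forall c c',
    smooth_on (ch A c @` (dom A c `&` dom A c')) (transition A c c')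
}.

(* The charts of M x R do not depend on the second coordinate of their centre. *)
Definition prod_line (R : realType) (E : normedModType R) (M : Type)
    (A : atlas E M) : atlas (E * R)%type (M * R)%type :=
  Atlas (fun c => [set q | dom A c.1 q.1])
        (fun c q => (ch A c.1 q.1, q.2))
        (fun c y => (chV A c.1 y.1, y.2)).

(* A vector bundle over M with typical fibre F is presented by its changes of
   frame: [T c c' q] sends the coordinates, relative to the chart c, of a
   vector of the fibre over q to its coordinates relative to the chart c'.
   The fibre over q is identified with F through the chart q, so that a
   section is a map M -> F and a base-fixing bundle map is a map
   M -> F -> F. *)
Definition frame_change (M F : Type) := M -> M -> M -> F -> F.

Definition local_section (R : realType) (E F : normedModType R) (M : Type)
    (A : atlas E M) (T : frame_change M F) (s : M -> F) (c : M) : E -> F :=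
  fun y => let q := chV A c y in T q c q (s q).

Definition smooth_section (R : realType) (E F : normedModType R) (M : Type)
    (A : atlas E M) (T : frame_change M F) (s : M -> F) : Prop :=
  forall c, smooth_on (target A c) (local_section A T s c).

Definition local_map (R : realType) (E F : normedModType R) (M : Type)
    (A : atlas E M) (T : frame_change M F) (h : M -> F -> F) (c : M) :
    E -> F -> F :=
  fun y w => let q := chV A c y in T q c q (h q (T c q q w)).

Definition bundle_morphism (R : realType) (E F : normedModType R) (M : Type)
    (A : atlas E M) (T : frame_change M F) (h : M -> F -> F) : Prop :=
  (forall q (a : R) (u v : F), h q (a *: u + v) = a *: h q u + h q v) /\
  (forall c (w : F), smooth_on (target A c) (fun y => local_map A T h c y w)).

Definition bapp (M F : Type) (h : M -> F -> F) (X : M -> F) : M -> F :=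
  fun p => h p (X p).

(* Vanishing of
     [JX,JY] - [X,Y] - J([JX,Y] + [X,JY])
   for all X, Y in a class of sections closed under the bracket and J. *)
Definition integrable_for (M : Type) (F : zmodType) (sec : (M -> F) -> Prop)
    (br : (M -> F) -> (M -> F) -> M -> F) (J : M -> F -> F) : Prop :=
  forall X Y : M -> F, sec X -> sec Y -> forall p : M,
    br (bapp J X) (bapp J Y) p - br X Y p
    - J p (br (bapp J X) Y p + br X (bapp J Y) p) = 0.

Definition tangent (R : realType) (E : normedModType R) (M : Type)
    (A : atlas E M) : frame_change M E :=
  fun c c' q => 'd (transition A c c') (ch A c q).

Definition vector_field (R : realType) (E : normedModType R) (M : Type)
    (A : atlas E M) (X : M -> E) : Prop := smooth_section A (tangent A) X.

Definition deriv (R : realType) (E : normedModType R) (M : Type)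
    (A : atlas E M) (X : M -> E) (f : M -> R) (p : M) : R :=
  'd (fun y => f (chV A p y)) (ch A p p) (X p).

(* In any chart, [X,Y] = DY(X) - DX(Y); at p we use the chart p. *)
Definition lie (R : realType) (E : normedModType R) (M : Type)
    (A : atlas E M) (X Y : M -> E) (p : M) : E :=
  'd (local_section A (tangent A) Y p) (ch A p p) (X p)
  - 'd (local_section A (tangent A) X p) (ch A p p) (Y p).

(* Integrability of an almost complex structure is the vanishing of its
   Nijenhuis torsion. *)
Definition integrable_acs (R : realType) (E : normedModType R) (M : Type)
    (A : atlas E M) (J : M -> E -> E) : Prop :=
  integrable_for (vector_field A) (lie A) J.

(* Tangent vectors are rows and covectors are columns. *)
Definition pairing (R : realType) (n : nat) (v : 'rV[R]_n) (a : 'cV[R]_n) : R :=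
  (v *m a) 0 0.

(* h^*(a) = a o h; [lin1_mx h] is the matrix of h acting on rows. *)
Definition transpose (R : realType) (n : nat) (h : 'rV[R]_n -> 'rV[R]_n)
    (a : 'cV[R]_n) : 'cV[R]_n :=
  lin1_mx h *m a.

Definition cotangent (R : realType) (n : nat) (M : Type)
    (A : atlas 'rV[R]_n M) : frame_change M 'cV[R]_n :=
  fun c c' q => transpose (tangent A c' c q).

Definition one_form (R : realType) (n : nat) (M : Type)
    (A : atlas 'rV[R]_n M) (a : M -> 'cV[R]_n) : Prop :=
  smooth_section A (cotangent A) a.

Definition covector (R : realType) (n : nat) (l : 'rV[R]_n -> R) : 'cV[R]_n :=
  \col_i l (delta_mx 0 i).

Definition diff_form (R : realType) (n : nat) (M : Type)
    (A : atlas 'rV[R]_n M) (f : M -> R) (p : M) : 'cV[R]_n :=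
  covector ('d (fun y => f (chV A p y)) (ch A p p)).

(* (da)_p(u, v) = D_u a (v) - D_v a (u) in the chart p, i.e.
   da(X,Y) = X(a(Y)) - Y(a(X)) - a([X,Y]) *)
Definition ext_deriv (R : realType) (n : nat) (M : Type)
    (A : atlas 'rV[R]_n M) (a : M -> 'cV[R]_n) (p : M) (u v : 'rV[R]_n) : R :=
  let Da := 'd (local_section A (cotangent A) a p) (ch A p p) in
  pairing v (Da u) - pairing u (Da v).

Definition int_ext_deriv (R : realType) (n : nat) (M : Type)
    (A : atlas 'rV[R]_n M) (Y : M -> 'rV[R]_n) (a : M -> 'cV[R]_n) (p : M) :
    'cV[R]_n :=
  covector (ext_deriv A a p (Y p)).

(* (L_X b)(v) = (D_X b)(v) + b(D_v X) in the chart p, i.e.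
   (L_X b)(Y) = X(b(Y)) - b([X,Y]) *)
Definition lie_form (R : realType) (n : nat) (M : Type)
    (A : atlas 'rV[R]_n M) (X : M -> 'rV[R]_n) (b : M -> 'cV[R]_n) (p : M) :
    'cV[R]_n :=
  'd (local_section A (cotangent A) b p) (ch A p p) (X p)
  + transpose ('d (local_section A (tangent A) X p) (ch A p p)) (b p).

Record almost_contact (R : realType) (n : nat) (M : Type)
    (A : atlas 'rV[R]_n M) (phi : M -> 'rV[R]_n -> 'rV[R]_n)
    (xi : M -> 'rV[R]_n) (eta : M -> 'cV[R]_n) : Prop := AlmostContact {
  ac_phi : bundle_morphism A (tangent A) phi;
  ac_xi : vector_field A xi;
  ac_eta : one_form A eta;
  ac_eta_xi : forall p, pairing (xi p) (eta p) = 1;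
  ac_phi_xi : forall p, phi p (xi p) = 0;
  ac_phi_eta : forall p, transpose (phi p) (eta p) = 0;
  ac_phi2 : forall p v,
    phi p (phi p v) = - v + pairing v (eta p) *: xi p
}.

(* X + f d/ds |-> phi X - f xi + eta(X) d/ds on M x R *)
Definition product_acs (R : realType) (n : nat) (M : Type)
    (phi : M -> 'rV[R]_n -> 'rV[R]_n)
    (xi : M -> 'rV[R]_n) (eta : M -> 'cV[R]_n) :
    (M * R)%type -> ('rV[R]_n * R)%type -> ('rV[R]_n * R)%type :=
  fun q v => (phi q.1 v.1 - v.2 *: xi q.1, pairing v.1 (eta q.1)).

Definition normal_almost_contact (R : realType) (n : nat) (M : Type)
    (A : atlas 'rV[R]_n M) (phi : M -> 'rV[R]_n -> 'rV[R]_n)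
    (xi : M -> 'rV[R]_n) (eta : M -> 'cV[R]_n) : Prop :=
  almost_contact A phi xi eta /\
  integrable_acs (prod_line A) (product_acs phi xi eta).

(* a pair (X, a) stands for X + a *)
Definition gfib (R : realType) (n : nat) : normedModType R :=
  ('rV[R]_n * 'cV[R]_n)%type.

Definition gtangent (R : realType) (n : nat) (M : Type)
    (A : atlas 'rV[R]_n M) : frame_change M (gfib R n) :=
  fun c c' q x => (tangent A c c' q x.1, cotangent A c c' q x.2).

Definition gmetric (R : realType) (n : nat) (x y : gfib R n) : R :=
  2^-1 * (pairing y.1 x.2 + pairing x.1 y.2).

Definition dorfman (R : realType) (n : nat) (M : Type)
    (A : atlas 'rV[R]_n M) (x y : M -> gfib R n) (p : M) : gfib R n :=
  let X q := (x q).1 in let a q := (x q).2 in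
  let Y q := (y q).1 in let b q := (y q).2 in
  (lie A X Y p, lie_form A X b p - int_ext_deriv A Y a p).

Record gen_almost_contact (R : realType) (n : nat) (M : Type)
    (A : atlas 'rV[R]_n M) (Phi : M -> gfib R n -> gfib R n)
    (e1 e2 : M -> gfib R n) : Prop := GenAlmostContact {
  gac_Phi : bundle_morphism A (gtangent A) Phi;
  gac_e1 : smooth_section A (gtangent A) e1;
  gac_e2 : smooth_section A (gtangent A) e2;
  gac_e11 : forall p, gmetric (e1 p) (e1 p) = 0;
  gac_e22 : forall p, gmetric (e2 p) (e2 p) = 0;
  gac_e12 : forall p, gmetric (e1 p) (e2 p) = 2^-1;
  gac_skew : forall p x y, gmetric (Phi p x) y = - gmetric x (Phi p y);
  gac_Phi_e1 : forall p, Phi p (e1 p) = 0;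
  gac_Phi_e2 : forall p, Phi p (e2 p) = 0;
  gac_Phi2 : forall p x,
    Phi p (Phi p x) = - x + (2 * gmetric x (e1 p)) *: e2 p
                          + (2 * gmetric x (e2 p)) *: e1 p
}.

Definition assoc_Phi (R : realType) (n : nat) (M : Type)
    (phi : M -> 'rV[R]_n -> 'rV[R]_n) : M -> gfib R n -> gfib R n :=
  fun p x => (phi p x.1, - transpose (phi p) x.2).

Definition assoc_e1 (R : realType) (n : nat) (M : Type)
    (xi : M -> 'rV[R]_n) : M -> gfib R n := fun p => (xi p, 0).

Definition assoc_e2 (R : realType) (n : nat) (M : Type)
    (eta : M -> 'cV[R]_n) : M -> gfib R n := fun p => (0, eta p).

(* (x, (f, g)) stands for x + f d/dt + g dt *)
Definition efib (R : realType) (n : nat) : normedModType R :=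
  (gfib R n * (R * R))%type.

Definition ebundle (R : realType) (n : nat) (M : Type)
    (A : atlas 'rV[R]_n M) : frame_change M (efib R n) :=
  fun c c' q x => (gtangent A c c' q x.1, x.2).

Definition emetric (R : realType) (n : nat) (x y : efib R n) : R :=
  gmetric x.1 y.1 + 2^-1 * (x.2.1 * y.2.2 + y.2.1 * x.2.2).

Definition ebracket (R : realType) (n : nat) (M : Type)
    (A : atlas 'rV[R]_n M) (X1 X2 : M -> efib R n) (p : M) : efib R n :=
  let x1 q := (X1 q).1 in let f1 q := (X1 q).2.1 in let g1 q := (X1 q).2.2 in
  let x2 q := (X2 q).1 in let f2 q := (X2 q).2.1 in let g2 q := (X2 q).2.2 in
  let a1 q := (x1 q).1 in let a2 q := (x2 q).1 in
  (dorfman A x1 x2 p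
     + (0, g2 p *: diff_form A f1 p + f2 p *: diff_form A g1 p),
   (deriv A a1 f2 p - deriv A a2 f1 p,
    deriv A a1 g2 p - deriv A a2 g1 p)).

Record associated_J (R : realType) (n : nat) (M : Type)
    (A : atlas 'rV[R]_n M) (Phi : M -> gfib R n -> gfib R n)
    (e1 e2 : M -> gfib R n) (J : M -> efib R n -> efib R n) : Prop :=
  AssociatedJ {
  aJ_morphism : bundle_morphism A (ebundle A) J;
  aJ_sqr : forall p x, J p (J p x) = - x;
  aJ_skew : forall p x y, emetric (J p x) y = - emetric x (J p y);
  aJ_vt : forall p, J p (0, (1, 0)) = (e1 p, (0, 0));
  aJ_dt : forall p, J p (0, (0, 1)) = (e2 p, (0, 0));
  aJ_e1 : forall p, J p (e1 p, (0, 0)) = (0, (- 1, 0));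
  aJ_e2 : forall p, J p (e2 p, (0, 0)) = (0, (0, - 1));
  aJ_perp : forall p x, gmetric x (e1 p) = 0 -> gmetric x (e2 p) = 0 ->
    J p (x, (0, 0)) = (Phi p x, (0, 0))
}.

(* There is exactly one J associated to a triple, so the existential merely
   names it. *)
Definition gen_normal (R : realType) (n : nat) (M : Type)
    (A : atlas 'rV[R]_n M) (Phi : M -> gfib R n -> gfib R n)
    (e1 e2 : M -> gfib R n) : Prop :=
  gen_almost_contact A Phi e1 e2 /\
  exists J : M -> efib R n -> efib R n,
    associated_J A Phi e1 e2 J /\
    integrable_for (smooth_section A (ebundle A)) (ebracket A) J.

(* Main.v *)
From HB Require Import structures.
Require Import Defs.
From mathcomp Require Import all_boot all_order all_algebra.
From mathcomp Require Import all_classical all_reals all_analysis.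
From mathcomp Require Import ring.

(** Put [L = TM + R].  On the one hand, [L] is the tangent bundle of [M x R]
   restricted to [M x {0}], and the almost complex structure [P] of [M x R] does
   not depend on the coordinate of the line.  On the other hand, [E'] is the sum
   of [L] and of its dual, its bracket is the Dorfman bracket of the Lie algebroid
   [L], and the morphism [J] associated to the triple is [P] on [L] and the
   opposite of the transpose [P^*] on the dual, up to the sign of [d/dt] and [dt]
   ([vec_gen_op], [ev_gen_op]).  It is the only such morphism, because [e1], [e2] and their
   orthogonal span [TM + T*M] ([associated_J_unique]).

   Hence both conditions express the vanishing of the same tensor.  In a chart,
   all derivatives of the sections cancel out of the Nijenhuis torsion, which
   leaves
     [N(v,w) = (D_{Pv} P) w - (D_{Pw} P) v + P (D_w P) v - P (D_v P) w],
   an expression of the values of the sections and of the first derivatives of [P]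
   ([nijenhuis_vec]).  This is the torsion on [M x R], and it is the component
   along [L] of the torsion of [J].  The component along the dual of the torsion of
   [J] at [X + a], [Y + b] is, evaluated on [z],
     [b (N(z,X)) + a (N(Y,z))]
   ([nijenhuis_covec]); it vanishes with [N].  So each of the two integrability
   conditions holds when [N = 0].  Conversely each of them forces [N = 0] at every point,
   provided that each vector is the value of a global smooth vector field
   ([vector_field_through]).  This last fact requires a bump function, built from
   [exp (-1/t)]. *)

Set Implicit Arguments.
Unset Strict Implicit.
Unset Printing Implicit Defensive.

Import Order.TTheory GRing.Theory Num.Theory.
Import numFieldNormedType.Exports.

Local Open Scope classical_set_scope.
Local Open Scope ring_scope.

(** * Differential calculus in finite dimension *)

Section Calculus.
Variable R : realType.
Implicit Types U V W B : normedModType R.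

Lemma is_diff_linear V W (f : V -> W) (x : V) :
  linear f -> continuous f -> is_diff x f f.
Proof.
move=> fl fc.
pose fM := GRing.isLinear.Build _ _ _ _ _ fl.
pose fL : {linear V -> W} := HB.pack f fM.
apply: DiffDef; first exact: (@linear_differentiable _ _ _ fL x fc).
exact: (@diff_lin _ _ _ fL x fc).
Qed.

(** Local representatives are computed on the domain of a chart only, so that
   differentials must depend on germs only. *)
Lemma is_diff_near V W (f g df : V -> W) (x : V) :
  (\near x, f x = g x) -> is_diff x f df -> is_diff x g df.
Proof.
move=> fg [fd <-].
have fgx : f x = g x := nbhs_singleton fg.
have E : g \o shift x = cst (g x) + 'd f x +o_ 0 id.
  apply/eqaddoP => e e0.
  have /eqaddoP/(_ e e0) H := diff_locally fd.
  near=> h.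
  have -> : (g \o shift x - (cst (g x) + 'd f x)) h
    = (f \o shift x - (cst (f x) + 'd f x)) h.
    rewrite /= !fctE /= fgx; congr (_ - _); apply/esym.
    by near: h; move: fg; rewrite (near_shift 0 x) subr0.
  by near: h.
have D := @diff_unique _ _ _ g ('d f x) x (diff_continuous fd) E.
apply: DiffDef => //; apply/diff_locallyP; rewrite D; split => //.
exact: diff_continuous fd.
Unshelve. all: by end_near. Qed.

(** Coordinates, rather than a dimension: they serve to expand vectors and
   linear maps, and products inherit them from their factors. *)
Definition findim V : Prop := exists (I : finType) (e : I -> V) (l : I -> V -> R),
  (forall i, linear (l i) /\ continuous (l i)) /\
  forall v, v = \sum_i l i v *: e i.

Lemma is_diffZV V W (k dk : V -> R) (f df : V -> W) (x : V) :
  is_diff x k dk -> is_diff x f df ->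
  is_diff x (fun y => k y *: f y) (fun u => k x *: df u + dk u *: f x).
Proof.
move=> dkx dfx.
have sb : bilinear_for (GRing.Scale.Law.clone _ _ *:%R _)
    (GRing.Scale.Law.clone _ _ *:%R _) (@GRing.scale R W).
  split=> [u'|u] a v w /=; first by rewrite scalerDl scalerA.
  by rewrite scalerDr !scalerA mulrC.
pose sM := bilinear_isBilinear.Build R R W W _ _ _ sb.
pose s : {bilinear R -> W -> W} := HB.pack (@GRing.scale R W) sM.
have sc : continuous (fun p : R * W => s p.1 p.2) by move=> p; exact: scale_continuous.
have dp := is_diff_pair dkx dfx.
have ds : is_diff (k x, f x) (fun p : R * W => s p.1 p.2)
    (fun q => s (k x) q.2 + s q.1 (f x)).
  apply: DiffDef; first exact: differentiable_bilin sc.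
  exact: (diff_bilin (f:=s) (k x, f x) sc).
exact: (is_diff_comp dp ds).
Qed.

Lemma is_diff_sum V W (I : finType) (f df : I -> V -> W) (x : V) :
  (forall i, is_diff x (f i) (df i)) ->
  is_diff x (fun y => \sum_i f i y) (fun u => \sum_i df i u).
Proof.
move=> H; elim: (index_enum I) => [|i s IH].
  under eq_fun do rewrite big_nil.
  under [X in is_diff_def _ _ X]eq_fun do rewrite big_nil.
  exact: is_diff_cst.
under eq_fun do rewrite big_cons.
under [X in is_diff_def _ _ X]eq_fun do rewrite big_cons.
exact: is_diffD.
Qed.

Lemma findim_R : findim (R : normedModType R).
Proof.
exists unit, (fun=> 1), (fun=> id); split => [_|v].
  by split=> //; move=> ?.
by rewrite (big_pred1 tt) => [|[]]//; rewrite /GRing.scale /= mulr1.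
Qed.

Lemma findim_mx m n : findim 'M[R]_(m, n).
Proof.
exists ('I_m * 'I_n)%type, (fun i => delta_mx i.1 i.2), (fun i (v : 'M[R]_(m, n)) => v i.1 i.2).
split => [[i j]|v]; first split.
- by move=> a u v; rewrite !mxE.
- exact: coord_continuous.
by rewrite {1}[v]matrix_sum_delta pair_bigA.
Qed.

Lemma findim_pair V W : findim V -> findim W -> findim (V * W)%type.
Proof.
move=> [I [e [l [H E]]]] [I' [e' [l' [H' E']]]].
exists (I + I')%type,
  (fun i => match i with inl i => (e i, 0) | inr i => (0, e' i) end),
  (fun i v => match i with inl i => l i v.1 | inr i => l' i v.2 end).
split => [[i|i]|[v w]].
- have [hl hc] := H i; split => [a u v|]; first exact: hl.
  by move=> u; apply: continuous_comp; [exact: cvg_fst | exact: hc].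
- have [hl hc] := H' i; split => [a u v|]; first exact: hl.
  by move=> u; apply: continuous_comp; [exact: cvg_snd | exact: hc].
rewrite big_sumType /=; rewrite {1}[v]E {1}[w]E'.
have -> : \sum_i l i v *: (e i, 0 : W) = (\sum_i l i v *: e i, 0).
  elim/big_rec2 : _ => // i z1 z2 _ ->.
  by congr pair; rewrite /= scaler0 addr0.
have -> : \sum_i l' i w *: (0 : V, e' i) = (0, \sum_i l' i w *: e' i).
  elim/big_rec2 : _ => // i z1 z2 _ ->.
  by congr pair; rewrite /= scaler0 addr0.
by congr pair; rewrite /= ?addr0 ?add0r.
Qed.

Lemma findim_continuous V W (f : V -> W) : findim V -> linear f -> continuous f.
Proof.
move=> [I [e [l [H E]]]] fl.
pose fM := GRing.isLinear.Build _ _ _ _ _ fl.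
pose fL : {linear V -> W} := HB.pack f fM.
have -> : f = (fun v => \sum_i l i v *: f (e i)).
  apply/funext => v; rewrite {1}[v]E -[f]/(fL : V -> W) linear_sum.
  by apply: eq_bigr => i _; rewrite linearZ.
move=> x; apply: cvg_big => [|i _]; first exact: add_continuous.
by apply: cvgZr_tmp; have [_] := H i; exact.
Qed.

Lemma is_diff_findim V W (f : V -> W) x : findim V -> linear f -> is_diff x f f.
Proof. by move=> V0 fl; apply: is_diff_linear => //; apply: findim_continuous. Qed.

(** Leibniz rule for a bundle map applied to a section.  The derivative of the
   bundle map is only given on each fixed vector [w]; an expansion of [X z] in
   coordinates reduces to that case. *)
Lemma is_diff_apply B V W (H : B -> V -> W) (X dX : B -> V) (DH : B -> V -> W) (y : B) :
  findim V -> (\near y, linear (H y)) ->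
  (forall w, is_diff y (fun z => H z w) (DH^~ w)) ->
  is_diff y X dX ->
  is_diff y (fun z => H z (X z)) (fun u => DH u (X y) + H y (dX u)).
Proof.
move=> [I [e [l [Hl E]]]] Hlin dH dXy.
have S z v : linear (H z) -> H z v = \sum_i l i v *: H z (e i).
  move=> hl; pose hM := GRing.isLinear.Build _ _ _ _ _ hl.
  pose hL : {linear V -> W} := HB.pack (H z) hM.
  rewrite {1}[v]E -[H z]/(hL : V -> W) linear_sum.
  by apply: eq_bigr => i _; rewrite linearZ.
have D : is_diff y (fun z => \sum_i l i (X z) *: H z (e i))
   (fun u => \sum_i (l i (X y) *: DH u (e i) + l i (dX u) *: H y (e i))).
  apply: is_diff_sum => i; apply: is_diffZV => //.
  have [ll lc] := Hl i.
  exact: (is_diff_comp dXy (is_diff_linear _ ll lc)).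
have := is_diff_near _ D; move=> /(_ (fun z => H z (X z))) [].
  by near=> z; rewrite -S//; near: z.
move=> D1 D2; apply: DiffDef => //; rewrite D2; apply/funext => u.
rewrite big_split /= -S; last exact: (nbhs_singleton Hlin).
congr (_ + _).
have Dl : linear (DH u).
  move=> a v w; have -> : DH u = (fun v => 'd (fun z => H z v) y u).
    by apply/funext => t; rewrite diff_val.
  have : is_diff y (fun z => H z (a *: v + w)) (a *: DH^~ v + DH^~ w).
    apply: is_diff_near (is_diffD (is_diffZ a (dH v)) (dH w)).
    by near=> z; rewrite !fctE; have -> : linear (H z) by near: z.
  by move=> [_ ->]; rewrite !diff_val.
rewrite {2}[X y]E.
pose hM := GRing.isLinear.Build _ _ _ _ _ Dl.
pose hL : {linear V -> W} := HB.pack (DH u) hM.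
rewrite -[DH u]/(hL : V -> W) linear_sum.
by apply: eq_bigr => i _; rewrite linearZ.
Unshelve. all: by end_near. Qed.

Lemma is_diff_fst (U V W : normedModType R) (f df : U -> V * W) x :
  is_diff x f df -> is_diff x (fun y => (f y).1) (fun u => (df u).1).
Proof.
move=> H; have l : linear (fst : V * W -> V) by [].
have c : continuous (fst : V * W -> V) by move=> ?; exact: cvg_fst.
exact: (is_diff_comp H (is_diff_linear _ l c)).
Qed.

Lemma is_diff_snd (U V W : normedModType R) (f df : U -> V * W) x :
  is_diff x f df -> is_diff x (fun y => (f y).2) (fun u => (df u).2).
Proof.
move=> H; have l : linear (snd : V * W -> W) by [].
have c : continuous (snd : V * W -> W) by move=> ?; exact: cvg_snd.
exact: (is_diff_comp H (is_diff_linear _ l c)).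
Qed.

Lemma is_diff_val_linear (V W : normedModType R) (f df : V -> W) x :
  is_diff x f df -> linear df.
Proof. by move=> [_ <-] k u v; rewrite linearP. Qed.

End Calculus.

(** * Classes of smooth functions *)

Section Smoothness.
Variable R : realType.
Implicit Types U V W B : normedModType R.

Lemma Ck_sub V W k (A B : set V) (f : V -> W) : A `<=` B -> Ck k B f -> Ck k A f.
Proof.
elim: k f => [|k IH] f AB /=; first by move=> H x /AB /H.
by move=> [H1 H2]; split=> [x /AB /H1//|v]; apply: IH.
Qed.

Lemma Ck_local V W k (A : set V) (f : V -> W) :
  (forall x, A x -> exists2 B : set V, B x & Ck k B f) -> Ck k A f.
Proof.
elim: k f => [|k IH] f H /=; first by move=> x /H[B Bx]; apply.
split=> [x Ax|v]; first by have [B Bx HB] := H x Ax; have := HB.1 x Bx.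
by apply: IH => x /H[B Bx [_ H2]]; exists B => //; exact: H2.
Qed.

Lemma Ck_eq V W k (A : set V) (f g : V -> W) :
  open A -> (forall x, A x -> f x = g x) -> Ck k A f -> Ck k A g.
Proof.
move=> oA; have near_eq (h1 h2 : V -> W) x :
    (forall x, A x -> h1 x = h2 x) -> A x -> \near x, h1 x = h2 x.
  by move=> h12 Ax; near=> z; apply: h12; near: z; apply: open_nbhs_nbhs.
elim: k f g => [|k IH] f g fg /=.
  move=> fc x Ax; have := fc x Ax; rewrite /prop_for /continuous_at -(fg x Ax).
  by apply: cvg_trans; apply: near_eq_cvg; apply: near_eq Ax => z /fg.
move=> [f1 f2]; split=> [x Ax|v].
  by have [] := is_diff_near (near_eq _ _ _ fg Ax) (differentiableP (f1 x Ax)).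
apply: IH (f2 v) => x Ax.
by have [_ ->] := is_diff_near (near_eq _ _ _ fg Ax) (differentiableP (f1 x Ax)).
Unshelve. all: by end_near. Qed.

Lemma CkS V W k (A : set V) (f : V -> W) : Ck k.+1 A f -> Ck k A f.
Proof.
elim: k f => [|k IH] f /=.
  by move=> [H _] x Ax; apply: differentiable_continuous; apply: H.
by move=> [H1 H2]; split => // v; apply: IH; apply: H2.
Qed.

(** Induction step of the closure properties below: it is enough to guess the
   differential and to check that it is of class C^k in the base point. *)
Lemma Ck_step V W k (A : set V) (f : V -> W) (df : V -> V -> W) :
  open A -> (forall x, A x -> is_diff x f (df x)) ->
  (forall v, Ck k A (df^~ v)) -> Ck k.+1 A f.
Proof.
move=> oA H1 H2; split=> [x /H1[]//|v].
by apply: Ck_eq (H2 v) => // x /H1[D E]; rewrite E.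
Qed.

Lemma Ck_is_diff V W (A : set V) (f : V -> W) k : Ck k.+1 A f ->
  forall x, A x -> is_diff x f ('d f x).
Proof. by move=> [H _] x /H; exact: differentiableP. Qed.

Lemma Ck_cst V W k (A : set V) (w : W) : open A -> Ck k A (fun=> w).
Proof.
move=> oA; elim: k w => [|k IH] w; first by move=> x _; exact: cst_continuous.
by apply: (@Ck_step _ _ _ _ _ (fun=> 0)) => // x _; exact: is_diff_cst.
Qed.

Lemma CkD V W k (A : set V) (f g : V -> W) : open A ->
  Ck k A f -> Ck k A g -> Ck k A (fun x => f x + g x).
Proof.
move=> oA; elim: k f g => [|k IH] f g Hf Hg.
  by move=> x Ax; apply: continuousD; [exact: Hf|exact: Hg].
apply: (@Ck_step _ _ _ _ _ (fun x v => 'd f x v + 'd g x v)) => // [x Ax|v].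
  by apply: is_diffD; [exact: Ck_is_diff Hf _ Ax|exact: Ck_is_diff Hg _ Ax].
by apply: IH; [apply Hf|apply Hg].
Qed.

Lemma Ck_sum V W k (A : set V) (I : finType) (f : I -> V -> W) : open A ->
  (forall i, Ck k A (f i)) -> Ck k A (fun x => \sum_i f i x).
Proof.
move=> oA H; elim: (index_enum I) => [|i s IH].
  by under eq_fun do rewrite big_nil; exact: Ck_cst.
by under eq_fun do rewrite big_cons; exact: CkD.
Qed.

Lemma Ck_postlin V W W' k (A : set V) (f : V -> W) (l : W -> W') : open A ->
  linear l -> continuous l -> Ck k A f -> Ck k A (fun x => l (f x)).
Proof.
move=> oA ll lc; elim: k f => [|k IH] f Hf.
  by move=> x Ax; apply: continuous_comp; [exact: Hf|exact: lc].
apply: (@Ck_step _ _ _ _ _ (fun x v => l ('d f x v))) => // [x Ax|v].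
  exact: (is_diff_comp (Ck_is_diff Hf Ax) (is_diff_linear (f x) ll lc)).
by apply: IH; apply Hf.
Qed.

Lemma Ck_prelin V W W' k (A : set V) (B : set W) (f : W -> W') (l : V -> W) : open A ->
  linear l -> continuous l -> (forall x, A x -> B (l x)) -> Ck k B f ->
  Ck k A (fun x => f (l x)).
Proof.
move=> oA ll lc AB; elim: k f => [|k IH] f Hf.
  by move=> x Ax; apply: continuous_comp; [exact: lc|apply: Hf; exact: AB].
apply: (@Ck_step _ _ _ _ _ (fun x v => 'd f (l x) (l v))) => // [x Ax|v].
  exact: (is_diff_comp (is_diff_linear x ll lc) (Ck_is_diff Hf (AB _ Ax))).
by apply: (IH (fun y => 'd f y (l v))); apply Hf.
Qed.

Lemma CkZV V W k (A : set V) (c : V -> R) (f : V -> W) : open A ->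
  Ck k A c -> Ck k A f -> Ck k A (fun x => c x *: f x).
Proof.
move=> oA; elim: k c f => [|k IH] c f Hc Hf.
  by move=> x Ax; apply: continuousZ; [exact: Hc|exact: Hf].
apply: (@Ck_step _ _ _ _ _ (fun x v => c x *: 'd f x v + 'd c x v *: f x)) => // [x Ax|v].
  by apply: is_diffZV; [exact: Ck_is_diff Hc _ Ax|exact: Ck_is_diff Hf _ Ax].
by apply: CkD => //; apply: IH; [exact: CkS|apply Hf|apply Hc|exact: CkS].
Qed.

Lemma Ck_pair V W W' k (A : set V) (f : V -> W) (g : V -> W') : open A ->
  Ck k A f -> Ck k A g -> Ck k A (fun x => (f x, g x)).
Proof.
move=> oA; elim: k f g => [|k IH] f g Hf Hg.
  by move=> x Ax; apply: cvg_pair; [exact: Hf|exact: Hg].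
apply: (@Ck_step _ _ _ _ _ (fun x v => ('d f x v, 'd g x v))) => // [x Ax|v].
  by apply: is_diff_pair; [exact: Ck_is_diff Hf _ Ax|exact: Ck_is_diff Hg _ Ax].
by apply: IH; [apply Hf|apply Hg].
Qed.

(** The differential of the composite is ['d f (g x) ('d g x v)]: the vector
   that it is applied to depends on [x], so it is expanded in coordinates to
   make the iterated differentials of [f] on fixed vectors appear. *)
Lemma Ck_comp V W W' k (A : set V) (B : set W) (f : W -> W') (g : V -> W) :
  findim W -> open A -> (forall x, A x -> B (g x)) ->
  Ck k B f -> Ck k A g -> Ck k A (fun x => f (g x)).
Proof.
move=> [I [e [l [Hl E]]]] oA AB; elim: k f => [|k IH] f Hf Hg.
  by move=> x Ax; apply: continuous_comp; [exact: Hg|apply: Hf; exact: AB].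
apply: (@Ck_step _ _ _ _ _ (fun x v => \sum_i l i ('d g x v) *: 'd f (g x) (e i)))
   => // [x Ax|v].
  have [D1 D2] := is_diff_comp (Ck_is_diff Hg Ax) (Ck_is_diff Hf (AB _ Ax)).
  apply: DiffDef => //; rewrite D2; apply/funext => v /=.
  rewrite {1}['d g x v]E linear_sum.
  by apply: eq_bigr => i _; rewrite linearZ.
apply: Ck_sum => // i; apply: CkZV => //.
  by have [ll lc] := Hl i; apply: Ck_postlin => //; apply Hg.
by apply: (IH (fun y => 'd f y (e i))); [apply Hf|exact: CkS].
Qed.

End Smoothness.

(** * Bump functions *)

Section Bump.
Variable R : realType.

(** Taking all polynomials [P] at once makes this class of functions stable
   under derivation, so that one differentiability statement gives smoothness. *)
Definition flat (P : {poly R}) (t : R) : R :=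
  if 0 < t then P.[t^-1] * expR (- t^-1) else 0.

Lemma poly_le_expR (Q : {poly R}) : exists2 C : R, 0 <= C &
  forall s, 0 < s -> `|Q.[s]| <= C * expR s.
Proof.
exists (\sum_(i < size Q) `|Q`_i| * i`!%:R) => [|s s0].
  by apply: sumr_ge0 => i _; rewrite mulr_ge0.
rewrite horner_coef mulr_suml (le_trans (ler_norm_sum _ _ _))//.
apply: ler_sum => i _; rewrite normrM -mulrA ler_wpM2l//.
rewrite ger0_norm; last by rewrite exprn_ge0 ?ltW.
case: (nat_of_ord i) => [|m].
  by rewrite expr0 fact0 mul1r; apply: le_trans (expR_ge1Dx s); rewrite lerDl ltW.
rewrite mulrC -ler_pdivrMr ?ltr0n ?fact_gt0//.
by apply: le_trans (expR_ge1Dxn m (ltW s0)); rewrite lerDr.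
Qed.

(** A quadratic bound, because the difference quotient at 0 has to tend to 0. *)
Lemma flat_le (P : {poly R}) : exists2 C : R, 0 <= C & forall t, `|flat P t| <= C * t ^+ 2.
Proof.
have [C C0 H] := poly_le_expR (P * 'X^2); exists C => // t; rewrite /flat.
case: ifPn => t0; last by rewrite normr0 mulr_ge0 ?sqr_ge0.
have := H t^-1; rewrite invr_gt0 => /(_ t0).
rewrite hornerM hornerXn normrM (ger0_norm (sqr_ge0 _)) => le1.
rewrite expRN normrM [X in _ * X]ger0_norm ?invr_ge0 ?expR_ge0//.
have e0 : 0 < expR t^-1 := expR_gt0 _.
have t2 : 0 < t ^+ 2 by rewrite exprn_gt0.
by rewrite ler_pdivrMr// mulrAC -ler_pdivrMr// -exprVn.
Qed.

Lemma is_diff_derive1 (f : R -> R) (x a : R) :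
  is_derive x 1 f a -> is_diff x f (fun u => u *: a).
Proof.
move=> [fx <-]; apply: DiffDef; first exact/derivable1_diffP.
by rewrite deriv1E// derive1E.
Qed.

Lemma flat_littleo (P : {poly R}) :
  flat P \o shift 0 = cst (flat P 0) + (fun=> 0) +o_ (0:R) id.
Proof.
apply/eqaddoP => e e0; have [C C0 H] := flat_le P.
have eC : 0 < e / (C + 1) by rewrite divr_gt0// ltr_wpDl.
have nC := @nbhs0_le R R _ eC.
near=> h; rewrite /= !fctE addr0 /= {2}/flat ltxx addr0 subr0.
apply: le_trans (H h) _; rewrite -[h ^+ 2]ger0_norm ?sqr_ge0// normrX expr2 mulrA.
rewrite ler_wpM2r//; apply: (@le_trans _ _ ((C + 1) * `|h|)).
  by rewrite ler_wpM2r// lerDl.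
rewrite mulrC -ler_pdivlMr ?ltr_wpDl//; near: h.
Unshelve. all: by end_near. Qed.

Lemma is_diff_flat (P : {poly R}) (t : R) :
  is_diff t (flat P) (fun u => u *: flat ('X^2 * (P - P^`())) t).
Proof.
have [t0|t0|t0] := ltrgtP 0 t.
- apply: (@is_diff_near R R R (fun t => P.[t^-1] * expR (- t^-1))).
    near=> z; rewrite /flat ifT//; near: z; exact: lt_nbhsr.
  have t1 : t != 0 by rewrite gt_eqF.
  have dinv : is_diff t (@GRing.inv R) (fun h => - t ^- 2 *: h).
    by apply: DiffDef; [exact: differentiable_Rinv|exact: diff_Rinv].
  have dp := is_diff_comp dinv (is_diff_derive1 (is_derive_poly P t^-1)).
  have de := is_diff_comp (is_diffN dinv) (is_diff_derive1 (is_derive_expR (- t^-1))).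
  have [D1 D2] := is_diffZV dp de.
  apply: DiffDef; first exact: D1.
  rewrite D2; apply/funext => u /=; rewrite /flat t0.
  rewrite hornerM hornerXn hornerD hornerN !fctE /GRing.scale /= -exprVn.
  ring.
- have -> : (fun u => u *: flat ('X^2 * (P - P^`())) t) = (fun u => 0).
    by apply/funext => u; rewrite /flat ifF ?scaler0// lt_gtF.
  apply: (@is_diff_near R R R (fun t => 0)).
    near=> z; rewrite /flat ifF//; apply/negbTE; rewrite -leNgt ltW//; near: z; exact: lt_nbhsl.
rewrite -t0.
have -> : (fun u => u *: flat ('X^2 * (P - P^`())) 0) = (fun u => 0).
  by apply/funext => u; rewrite /flat ltxx ?scaler0.
have D := flat_littleo P.
have zc : continuous (\0 : {linear R -> R})%R by move=> x; exact: cst_continuous.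
have D1 := @diff_unique R _ _ (flat P) _ 0 zc D.
apply: DiffDef => //; apply/diff_locallyP; rewrite D1; split => //.
Unshelve. all: by end_near. Qed.

Lemma smooth_flat (P : {poly R}) : smooth_on setT (flat P).
Proof.
move=> k; elim: k P => [|k IH] P.
  by move=> x _; apply: differentiable_continuous; have [] := is_diff_flat P x.
apply: (@Ck_step R R R k setT (flat P) (fun t u => u *: flat ('X^2 * (P - P^`())) t)).
- exact: openT.
- by move=> x _; exact: is_diff_flat.
move=> v; apply: CkZV; [exact: openT|apply: Ck_cst; exact: openT|exact: IH].
Qed.

(** The flat function of [r^2 - |y - y0|^2] for the Euclidean norm, which is
   polynomial in the coordinates.  The ball is that of the sup norm: off this ball a
   single coordinate already makes the Euclidean distance exceed [r]. *)
Lemma smooth_bump n (y0 : 'rV[R]_n) (r : R) : 0 < r ->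
  exists psi : 'rV[R]_n -> R, [/\ smooth_on setT psi, psi y0 = 1 &
    forall y, ~ closed_ball y0 r y -> psi y = 0].
Proof.
move=> r0; pose q (y : 'rV[R]_n) := r ^+ 2 - \sum_(i < n) (y 0 i - y0 0 i) ^+ 2.
have c0 : flat 1 (r ^+ 2) != 0.
  by rewrite /flat exprn_gt0// hornerC mul1r gt_eqF// expR_gt0.
exists (fun y => (flat 1 (r ^+ 2))^-1 *: flat 1 (q y)); split.
- move=> k; apply: CkZV; [exact: openT|apply: Ck_cst; exact: openT|].
  apply: (Ck_comp (B:=setT)) => //; [exact: findim_R|exact: openT|exact: smooth_flat|].
  have oT : open (setT : set 'rV[R]_n) by exact: openT.
  rewrite /q.
  have -> : (fun y : 'rV[R]_n => r ^+ 2 - \sum_(i < n) (y 0 i - y0 0 i) ^+ 2)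
     = (fun y => r ^+ 2 + \sum_(i < n) ((- (y 0 i - y0 0 i)) *: (y 0 i - y0 0 i))).
    apply/funext => y; rewrite -sumrN; congr (_ + _).
    by apply: eq_bigr => i _; rewrite /GRing.scale /= mulNr expr2.
  apply: CkD => //; first exact: Ck_cst.
  apply: Ck_sum => // i.
  have hi : Ck k setT (fun y : 'rV[R]_n => y 0 i - y0 0 i).
    apply: CkD => //; last exact: Ck_cst.
    apply: (Ck_prelin (B:=setT) (f:=id) (l:=(fun y : 'rV[R]_n => y 0 i))) => //.
    - by move=> a u v; rewrite !mxE.
    - exact: coord_continuous.
    case: k => [|k]; first by move=> x _; exact: cvg_id.
    apply: (Ck_step (df:=fun _ u => u)); first exact: openT.
    by move=> v; apply: Ck_cst; exact: openT.
  apply: CkZV => //.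
  apply: (Ck_postlin (l:=fun x => -x)) => //.
  - by move=> a u v; rewrite opprD scalerN.
  - exact: opp_continuous.
- rewrite /q big1 ?subr0 => [|i _]; first by rewrite /GRing.scale/= mulVf.
  by rewrite subrr expr0n.
- move=> y; rewrite closed_ballE//= => /negP; rewrite -ltNge => ry.
  have q0 : q y <= 0; last by rewrite [X in _ *: X]/flat ltNge q0 scaler0.
  rewrite /q subr_le0.
  have n0 : mx_norm (y0 - y) != 0.
    by rewrite -[mx_norm _]/`|y0 - y| gt_eqF// (lt_trans r0).
  have [[i j] /= E] := mx_norm_neq0 n0.
  move: ry; rewrite [`|_|]E ord1 !mxE distrC => ry.
  rewrite (bigD1 j)//= (le_trans (y := (y 0 j - y0 0 j) ^+ 2))//; last first.
    by rewrite lerDl sumr_ge0// => k _; rewrite sqr_ge0.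
  rewrite -[leRHS]ger0_norm ?sqr_ge0// normrX ler_pXn2r ?nnegrE ?(ltW r0) ?(ltW ry)//.
Qed.

End Bump.

(** * Charts and global vector fields *)

Section Manifold.
Variables (R : realType) (n : nat) (M : topologicalType) (A : atlas 'rV[R]_n M).
Hypothesis hA : smooth_manifold A.
Local Notation E := 'rV[R]_n.
Local Notation T := (tangent A).

Lemma targetP c y : target A c y -> dom A c (chV A c y) /\ ch A c (chV A c y) = y.
Proof. by move=> [q Dq <-]; rewrite mfd_chK. Qed.

Lemma target_ch c q : dom A c q -> target A c (ch A c q).
Proof. by exists q. Qed.

Lemma overlapE c c' : ch A c @` (dom A c `&` dom A c') =
  target A c `&` (chV A c @^-1` dom A c').
Proof.
apply/seteqP; split => y /=.
  by move=> [q [Dq Dq'] <-]; rewrite (mfd_chK hA Dq); split => //; exact: target_ch.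
by move=> [/targetP[D e] D']; exists (chV A c y).
Qed.

Lemma open_overlap c c' : open (ch A c @` (dom A c `&` dom A c')).
Proof.
rewrite overlapE openE => y [Ty Dy]; apply: filterI.
  by apply: open_nbhs_nbhs; split => //; exact: (mfd_target_open hA).
apply: (mfd_chV_cont hA Ty); apply: open_nbhs_nbhs; split => //.
exact: (mfd_dom_open hA).
Qed.

Lemma near_overlap c c' q : dom A c q -> dom A c' q ->
  \forall y \near ch A c q, target A c y /\ dom A c' (chV A c y).
Proof.
move=> D D'.
have : nbhs (ch A c q) (ch A c @` (dom A c `&` dom A c')).
  by apply: open_nbhs_nbhs; split; [exact: open_overlap | exists q].
by rewrite overlapE.
Qed.

Lemma is_diff_transition c c' q : dom A c q -> dom A c' q ->
  is_diff (ch A c q) (transition A c c') (T c c' q).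
Proof.
move=> D D'; have H := mfd_compat hA c c'.
by apply: (Ck_is_diff (H 1%N)); exists q.
Qed.

Lemma tangent_linear c c' q : linear (T c c' q).
Proof. by move=> a u v; rewrite /tangent linearP. Qed.

Lemma tangentZ c c' q a v : T c c' q (a *: v) = a *: T c c' q v.
Proof. by rewrite /tangent linearZ. Qed.

Lemma tangent0 c c' q : T c c' q 0 = 0.
Proof. by rewrite /tangent linear0. Qed.

Lemma tangent_id c q : dom A c q -> T c c q = id.
Proof.
move=> D; have [_ <-] := is_diff_transition D D.
have H := near_overlap D D.
have [_ ->//] : is_diff (ch A c q) (transition A c c) id.
apply: (@is_diff_near _ _ _ id).
near=> y; have [Ty _] : target A c y /\ dom A c (chV A c y) by near: y.
by rewrite /transition (targetP Ty).2.
Unshelve. all: by end_near. Qed.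

Lemma tangent_comp c c' c'' q v : dom A c q -> dom A c' q -> dom A c'' q ->
  T c' c'' q (T c c' q v) = T c c'' q v.
Proof.
move=> D D' D''.
have H := near_overlap D D'.
have e : transition A c c' (ch A c q) = ch A c' q.
  by rewrite /transition (mfd_chK hA D).
have D2 : is_diff (transition A c c' (ch A c q)) (transition A c' c'') (T c' c'' q).
  by rewrite e; exact: is_diff_transition.
have D3 := is_diff_comp (is_diff_transition D D') D2.
have [_ E1] : is_diff (ch A c q) (transition A c c'') (T c' c'' q \o T c c' q).
  apply: is_diff_near D3; near=> y.
  have [Ty Dy] : target A c y /\ dom A c' (chV A c y) by near: y.
  by rewrite /transition /= (mfd_chK hA Dy).
by rewrite [RHS](congr1 (fun f => f v) E1).
Unshelve. all: by end_near. Qed.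

Lemma tangentK c c' q : dom A c q -> dom A c' q ->
  cancel (T c c' q) (T c' c q).
Proof. by move=> D D' v; rewrite tangent_comp// tangent_id. Qed.

(** This is how the vanishing of a torsion on sections becomes the vanishing of
   a tensor.  A constant field in the chart at [p] is cut off by a bump function;
   the support, compact in the chart, is closed in the manifold because [M] is
   Hausdorff, so that the extension by 0 is smooth. *)
Lemma vector_field_through p v : exists2 Z, vector_field A Z & Z p = v.
Proof.
set y0 := ch A p p.
have Dp := mfd_center hA p.
have Ty0 : target A p y0 by exact: target_ch.
have [r r0 Br] : exists2 r, 0 < r & closed_ball y0 r `<=` target A p.
  have : nbhs y0 (target A p) by apply: open_nbhs_nbhs; split => //; exact: (mfd_target_open hA).
  move=> /nbhs_closedballP[r rT]; exists r%:num => //.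
have [psi [psiS psi1 psi0]] := smooth_bump y0 r0.
pose K := chV A p @` closed_ball y0 r.
have Kc : closed K.
  apply: compact_closed; first exact: (mfd_hausdorff hA).
  apply: continuous_compact.
    apply: continuous_in_subspaceT => y /set_mem /Br; exact: (mfd_chV_cont hA).
  apply: bounded_closed_compact; last exact: closed_ball_closed.
  exists (`|y0| + r); split; first exact: num_real.
  move=> N /ltW rN y /=; rewrite closed_ballE// /closed_ball_/= => yr.
  apply: le_trans rN; rewrite -[y](subKr y0) (le_trans (ler_normB _ _))//.
  by rewrite lerD2l.
pose Z q := if `[< dom A p q >] then psi (ch A p q) *: T p q q v else 0.
exists Z; last first.
  by rewrite /Z (asboolT Dp) psi1 scale1r tangent_id.
move=> c k; apply: Ck_local => y Ty; have [Dc ey] := targetP Ty.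
have [Dq|Dq] := pselect (dom A p (chV A c y)).
  (* on the overlap, [Z] is a smooth vector function of the transition map *)
  set B := ch A c @` (dom A c `&` dom A p).
  have oB : open B by exact: open_overlap.
  exists B; first by rewrite /B overlapE.
  apply: (@Ck_eq _ _ _ _ _ (fun y => psi (transition A c p y) *:
     'd (transition A p c) (transition A c p y) v)) => //.
    move=> z; rewrite /B overlapE=> -[Tz Dz].
    rewrite /local_section /Z (asboolT Dz) tangentZ; congr (_ *: _).
    have [Dz' _] := targetP Tz.
    by rewrite tangent_comp//; exact: (mfd_center hA).
  set B' := ch A p @` (dom A p `&` dom A c).
  apply: (@Ck_comp _ _ _ _ _ _ B' (fun z => psi z *: 'd (transition A p c) z v)) => //.
  - exact: findim_mx.
  - move=> z [q [Dqc Dqp] <-]; exists q => //.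
    by rewrite /transition (mfd_chK hA Dqc).
  - apply: CkZV; first exact: open_overlap.
      by apply: Ck_sub (psiS k).
    by have [_] := mfd_compat hA p c k.+1; exact.
  - exact: (mfd_compat hA c p k).
(* off the chart at [p], [Z] vanishes on the open complement of [K] *)
exists (target A c `&` (chV A c @^-1` (~` K))).
  split => //= -[z /Br Tz ez]; apply: Dq; rewrite -ez; exact: (targetP Tz).1.
have oN : open (target A c `&` chV A c @^-1` (~` K)).
  rewrite openE => z [Tz Kz]; apply: filterI.
    by apply: open_nbhs_nbhs; split => //; exact: (mfd_target_open hA).
  apply: (mfd_chV_cont hA Tz); apply: open_nbhs_nbhs; split => //.
  exact: closed_openC.
apply: (@Ck_eq _ _ _ _ _ (fun=> 0)) => //; last exact: Ck_cst.
move=> z [Tz Kz]; rewrite /local_section /Z.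
case: asboolP => D; last by rewrite tangent0.
rewrite psi0 ?scale0r ?tangent0// => H; apply: Kz.
by exists (ch A p (chV A c z)) => //; exact: mfd_chK.
Qed.

End Manifold.

(** * Pointwise algebra of the Nijenhuis torsion *)

Section LinearFun.
Variables (R : realType) (V W : lmodType R) (f : V -> W).
Hypothesis fl : linear f.
Let fM := GRing.isLinear.Build _ _ _ _ _ fl.
Let fL : {linear V -> W} := HB.pack f fM.

Lemma linD x y : f (x + y) = f x + f y.
Proof. exact: (raddfD fL). Qed.

Lemma linB x y : f (x - y) = f x - f y.
Proof. exact: (raddfB fL). Qed.

Lemma linN x : f (- x) = - f x.
Proof. exact: (raddfN fL). Qed.

Lemma linZ k x : f (k *: x) = k *: f x.
Proof. by rewrite -[f]/(fL : V -> W) linearZ. Qed.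

End LinearFun.

Section Algebra.
Variables (R : realType) (n : nat).
Local Notation E := 'rV[R]_n.
Local Notation Ed := 'cV[R]_n.
Implicit Types (u v : E) (a b : Ed) (p q : E * R) (c d : Ed * R).

Lemma pairingDl u v a : pairing (u + v) a = pairing u a + pairing v a.
Proof. by rewrite /pairing mulmxDl mxE. Qed.

Lemma pairingZl k v a : pairing (k *: v) a = k * pairing v a.
Proof. by rewrite /pairing -scalemxAl mxE. Qed.

Lemma pairingDr v a b : pairing v (a + b) = pairing v a + pairing v b.
Proof. by rewrite /pairing mulmxDr mxE. Qed.

Lemma pairingZr k v a : pairing v (k *: a) = k * pairing v a.
Proof. by rewrite /pairing -scalemxAr mxE. Qed.

Lemma pairing0l a : pairing 0 a = 0.
Proof. by rewrite -(scale0r (0 : E)) pairingZl mul0r. Qed.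

Lemma pairing0r v : pairing v 0 = 0.
Proof. by rewrite -(scale0r (0 : Ed)) pairingZr mul0r. Qed.

Lemma pairingNl v a : pairing (- v) a = - pairing v a.
Proof. by rewrite -scaleN1r pairingZl mulN1r. Qed.

Lemma pairingNr v a : pairing v (- a) = - pairing v a.
Proof. by rewrite -scaleN1r pairingZr mulN1r. Qed.

Definition pairingE := (pairingDl, pairingDr, pairingNl, pairingNr,
  pairingZl, pairingZr, pairing0l, pairing0r).

Lemma pairing_delta i a : pairing (delta_mx 0 i) a = a i 0.
Proof. by rewrite /pairing -rowE mxE. Qed.

Lemma pairing_inj a b : (forall v, pairing v a = pairing v b) -> a = b.
Proof. by move=> H; apply/matrixP => i j; rewrite ord1 -!pairing_delta. Qed.

Lemma pairing_transpose (h : E -> E) v a : linear h ->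
  pairing v (transpose h a) = pairing (h v) a.
Proof.
move=> hl; pose hM := GRing.isLinear.Build _ _ _ _ _ hl.
pose hL : {linear E -> E} := HB.pack h hM.
by rewrite /pairing /transpose mulmxA -[h]/(hL : E -> E) mul_rV_lin1.
Qed.

Lemma pairing_covector (l : E -> R) v : linear l -> pairing v (covector l) = l v.
Proof.
move=> hl; pose hM := GRing.isLinear.Build _ _ _ _ _ hl.
pose hL : {linear E -> R} := HB.pack l hM.
rewrite {2}[v]row_sum_delta -[l]/(hL : E -> R) linear_sum /pairing mxE.
by apply: eq_bigr => i _; rewrite linearZ mxE.
Qed.

(** The value at a point of the almost complex structure of [M x R]. *)
Definition acs_op (phi : E -> E) (xi : E) (eta : Ed) (v : E * R) : E * R :=
  (phi v.1 - v.2 *: xi, pairing v.1 eta).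

(** The only possible value of the morphism associated to the triple; see
   [associated_J_unique]. *)
Definition gen_op (phi : E -> E) (xi : E) (eta : Ed) (x : efib R n) : efib R n :=
  ((phi x.1.1 + x.2.1 *: xi, - transpose phi x.1.2 + x.2.2 *: eta),
   (- pairing x.1.1 eta, - pairing xi x.1.2)).

(** With [L = TM + R], the maps [vec] and [covec] identify [E'] with the sum of
   [L] and its dual, and [ev] is the duality.  On [M x R] the structure sends [xi] to
   [d/ds], whereas [J] sends it to [- d/dt]: the signs below match these
   orientations, and turn [J] into [P] plus the opposite of its transpose. *)
Definition vec (x : efib R n) : E * R := (x.1.1, - x.2.1).
Definition covec (x : efib R n) : Ed * R := (x.1.2, - x.2.2).
Definition ev (v : E * R) (a : Ed * R) : R := pairing v.1 a.1 + v.2 * a.2.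

Lemma evDl p q c : ev (p + q) c = ev p c + ev q c.
Proof. by rewrite /ev pairingDl mulrDl addrACA. Qed.

Lemma evNl p c : ev (- p) c = - ev p c.
Proof. by rewrite /ev pairingNl mulNr opprD. Qed.

Lemma evDr p c d : ev p (c + d) = ev p c + ev p d.
Proof. by rewrite /ev pairingDr mulrDr addrACA. Qed.

Lemma evNr p c : ev p (- c) = - ev p c.
Proof. by rewrite /ev pairingNr mulrN opprD. Qed.

Lemma vec_linear : linear vec.
Proof.
move=> k x y; congr pair; rewrite /= opprD; congr (_ + _).
exact/esym/scalerN.
Qed.

Lemma ev_covec_linear z : linear (fun x => ev z (covec x)).
Proof.
move=> k x y; rewrite /ev /covec /= !pairingE opprD mulrDr /GRing.scale /=.
ring.
Qed.

Lemma efib_eq0 (x : efib R n) : vec x = 0 -> (forall z, ev z (covec x) = 0) -> x = 0.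
Proof.
move: x => [[X a] [f g]] [-> /eqP]; rewrite oppr_eq0 => /eqP -> H.
have -> : a = 0.
  apply: pairing_inj => v; rewrite pairing0r.
  by have := H (v, 0); rewrite /ev /= mul0r addr0.
have := H (0, 1); rewrite /ev /= pairing0l add0r mul1r => /eqP.
by rewrite oppr_eq0 => /eqP ->.
Qed.

(** The two components of [J = P - P^*]. *)
Lemma vec_gen_op phi xi eta x : linear phi -> vec (gen_op phi xi eta x) = acs_op phi xi eta (vec x).
Proof. by move=> ?; rewrite /vec /acs_op /= scaleNr !opprK. Qed.

Lemma ev_gen_op phi xi eta z x : linear phi ->
  ev z (covec (gen_op phi xi eta x)) = - ev (acs_op phi xi eta z) (covec x).
Proof.
move=> pl; rewrite /ev /covec /acs_op /= !pairingE pairing_transpose//.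
ring.
Qed.

Lemma acs_op_linear phi xi eta : linear phi -> linear (acs_op phi xi eta).
Proof.
move=> pl k p q; rewrite /acs_op /= !pairingE pl; congr pair.
by rewrite /= scalerDl scalerBr scalerA opprD addrACA.
Qed.

Lemma gen_op_linear phi xi eta : linear phi -> linear (gen_op phi xi eta).
Proof.
move=> pl k x y; apply/subr0_eq/efib_eq0 => [|z].
  rewrite (linB vec_linear) (vec_linear k) !vec_gen_op// vec_linear acs_op_linear//.
  exact: subrr.
rewrite (linB (ev_covec_linear z)) (ev_covec_linear z k) !ev_gen_op//.
by rewrite ev_covec_linear /GRing.scale /=; ring.
Qed.

End Algebra.

Lemma findim_line (R : realType) n : findim (('rV[R]_n * R)%type : normedModType R).
Proof. by apply: findim_pair; [exact: findim_mx | exact: findim_R]. Qed.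

Lemma findim_efib (R : realType) n : findim (efib R n).
Proof. by do !apply: findim_pair; first [exact: findim_mx | exact: findim_R]. Qed.

Section Torsion.
Variables (R : realType) (n : nat).
Local Notation L := ('rV[R]_n * R)%type.
Variables (K : L -> L) (DK : L -> L -> L).
Hypotheses (Kl : linear K) (KK : forall v, K (K v) = - v).

(** The Nijenhuis tensor of an almost complex structure [K] with derivative
   [DK] in a chart. *)
Definition torsion (v w : L) : L :=
  DK (K v) w - DK (K w) v + K (DK w v) - K (DK v w).

(** [DX] and [DY] are the derivatives of two sections of values [X] and [Y];
   those of [K X] and [K Y] come from the Leibniz rule.  All derivatives of
   the sections cancel. *)
Lemma nijenhuis_vec (X Y : L) (DX DY : L -> L) :
  let DKX u := DK u X + K (DX u) in
  let DKY u := DK u Y + K (DY u) in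
  (DKY (K X) - DKX (K Y)) - (DY X - DX Y)
    - K ((DY (K X) - DKX Y) + (DKY X - DX (K Y))) = torsion X Y.
Proof.
move=> /=; rewrite /torsion !(linD Kl, linB Kl, linN Kl, KK).
move: (DK (K X) Y) (DK (K Y) X) (K (DK X Y)) (K (DK Y X)) (K (DY (K X)))
  (K (DX (K Y))) (DY X) (DX Y) => [a1 b1] [a2 b2] [a3 b3] [a4 b4] [a5 b5] [a6 b6]
  [a7 b7] [a8 b8].
by congr pair; [apply/rowP => i; rewrite !mxE|]; rewrite /=; ring.
Qed.

(** The same cancellation for the covector component of the Dorfman bracket,
   on which [J] acts by the opposite of the transpose of [K]; it is evaluated on
   a vector [z].  [Ja], [DJa] stand for the image of the covector [a] and for
   its derivative. *)
Lemma nijenhuis_covec (X Y z : L) (a b Ja Jb : 'cV[R]_n * R)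
    (DX DY : L -> L) (Da Db DJa DJb : L -> 'cV[R]_n * R) :
  (forall u v, DK u (K v) = - K (DK u v)) ->
  (forall w, ev w Ja = - ev (K w) a) -> (forall w, ev w Jb = - ev (K w) b) ->
  (forall u w, ev w (DJa u) = - ev (DK u w) a - ev (K w) (Da u)) ->
  (forall u w, ev w (DJb u) = - ev (DK u w) b - ev (K w) (Db u)) ->
  let DKX u := DK u X + K (DX u) in
  let DKY u := DK u Y + K (DY u) in
  let br w Y' X' (DX' : L -> L) b' Db' Da' :=
    ev w (Db' X') + ev (DX' w) b' - ev w (Da' Y') + ev Y' (Da' w) in
  br z (K Y) (K X) DKX Jb DJb DJa - br z Y X DX b Db Da
    + (br (K z) Y (K X) DKX b Db DJa + br (K z) (K Y) X DX Jb DJb Da)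
  = ev (torsion z X) b + ev (torsion Y z) a.
Proof.
move=> DKK eJa eJb eDJa eDJb /=; rewrite /torsion.
rewrite !(eJa, eJb, eDJa, eDJb, evDl, evNl, evDr, evNr, linD Kl, linN Kl, KK, DKK).
ring.
Qed.

End Torsion.

(** * Brackets in a chart *)

Lemma lie_of_diff (R : realType) (E : normedModType R) (M : Type) (A : atlas E M)
    (X Y : M -> E) p (DX DY : E -> E) :
  is_diff (ch A p p) (local_section A (tangent A) X p) DX ->
  is_diff (ch A p p) (local_section A (tangent A) Y p) DY ->
  lie A X Y p = DY (X p) - DX (Y p).
Proof.
move=> [_ dX] [_ dY]; rewrite /lie; congr (_ - _).
  exact: (congr1 (fun f => f (X p)) dY).
exact: (congr1 (fun f => f (Y p)) dX).
Qed.

Section LocalForms.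
Variables (R : realType) (n : nat) (M : topologicalType) (A : atlas 'rV[R]_n M).
Local Notation E := 'rV[R]_n.
Local Notation T := (tangent A).

Lemma deriv_of_diff (X : M -> E) (f : M -> R) p (df : E -> R) :
  is_diff (ch A p p) (fun y => f (chV A p y)) df -> Defs.deriv A X f p = df (X p).
Proof. by move=> [_ df_]; exact: (congr1 (fun f => f (X p)) df_). Qed.

Lemma pairing_diff_form (f : M -> R) p (df : E -> R) v :
  is_diff (ch A p p) (fun y => f (chV A p y)) df -> pairing v (diff_form A f p) = df v.
Proof.
move=> df_; rewrite -(pairing_covector v (is_diff_val_linear df_)).
by have [_ e] := df_; rewrite /diff_form; congr (pairing _ (covector _)).
Qed.

Lemma pairing_lie_form (X : M -> E) (b : M -> 'cV[R]_n) p (DX : E -> E) (Db : E -> 'cV[R]_n) v :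
  is_diff (ch A p p) (local_section A T X p) DX ->
  is_diff (ch A p p) (local_section A (cotangent A) b p) Db ->
  pairing v (lie_form A X b p) = pairing v (Db (X p)) + pairing (DX v) (b p).
Proof.
move=> dX db; rewrite -(pairing_transpose _ _ (is_diff_val_linear dX)) -pairingDr.
have [_ e] := dX; have [_ e'] := db; rewrite /lie_form; congr (pairing _ (_ + _)).
  exact: (congr1 (fun f => f (X p)) e').
by congr (transpose _ _).
Qed.

Lemma pairing_int_ext_deriv (Y : M -> E) (a : M -> 'cV[R]_n) p (Da : E -> 'cV[R]_n) v :
  is_diff (ch A p p) (local_section A (cotangent A) a p) Da ->
  pairing v (int_ext_deriv A Y a p) = pairing v (Da (Y p)) - pairing (Y p) (Da v).
Proof.
move=> da; have Dl := is_diff_val_linear da; have [_ e] := da.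
rewrite -(@pairing_covector _ _ (fun v => pairing v (Da (Y p)) - pairing (Y p) (Da v))).
  rewrite /int_ext_deriv; congr (pairing _ (covector _)); apply/funext => w.
  rewrite /ext_deriv /=; apply: (congr2 (fun s t => pairing w s - pairing (Y p) t)).
    exact: (congr1 (fun f => f (Y p)) e).
  exact: (congr1 (fun f => f w) e).
by move=> k u w; rewrite Dl !pairingE /GRing.scale /=; ring.
Qed.

(** The bracket of [E'] is the Dorfman bracket [ [X,Y] + L_X b - i_Y da ] of the Lie
   algebroid [L = TM + R], of anchor the first projection.  This is its expression
   by the values [x1], [x2] and the derivatives [D1], [D2] of the two sections.
   The torsion of [J] depends on the four brackets only through it. *)
Definition bracket_of_jets (x1 x2 : efib R n) (D1 D2 : E -> efib R n) (b : efib R n) :=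
  vec b = vec (D2 (vec x1).1) - vec (D1 (vec x2).1) /\
  forall z, ev z (covec b) =
    ev z (covec (D2 (vec x1).1)) + ev (vec (D1 z.1)) (covec x2)
    - ev z (covec (D1 (vec x2).1)) + ev (vec x2) (covec (D1 z.1)).

Section Bracket.
Variables (X1 X2 : M -> efib R n) (p : M) (D1 D2 : E -> efib R n).
Hypotheses (d1 : is_diff (ch A p p) (local_section A (ebundle A) X1 p) D1)
  (d2 : is_diff (ch A p p) (local_section A (ebundle A) X2 p) D2).

Let dv (X : M -> efib R n) D :
  is_diff (ch A p p) (local_section A (ebundle A) X p) D ->
  is_diff (ch A p p) (local_section A T (fun q => (X q).1.1) p) (fun u => (D u).1.1).
Proof. by move=> d; exact: is_diff_fst (is_diff_fst d). Qed.

Let da (X : M -> efib R n) D :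
  is_diff (ch A p p) (local_section A (ebundle A) X p) D ->
  is_diff (ch A p p) (local_section A (cotangent A) (fun q => (X q).1.2) p)
    (fun u => (D u).1.2).
Proof. by move=> d; exact: is_diff_snd (is_diff_fst d). Qed.

Let df (X : M -> efib R n) D :
  is_diff (ch A p p) (local_section A (ebundle A) X p) D ->
  is_diff (ch A p p) (fun y => (X (chV A p y)).2.1) (fun u => (D u).2.1).
Proof. by move=> d; exact: is_diff_fst (is_diff_snd d). Qed.

Let dg (X : M -> efib R n) D :
  is_diff (ch A p p) (local_section A (ebundle A) X p) D ->
  is_diff (ch A p p) (fun y => (X (chV A p y)).2.2) (fun u => (D u).2.2).
Proof. by move=> d; exact: is_diff_snd (is_diff_snd d). Qed.

Lemma ebracketP : bracket_of_jets (X1 p) (X2 p) D1 D2 (ebracket A X1 X2 p).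
Proof.
split=> [|z].
  have e1 := lie_of_diff (dv d1) (dv d2).
  have e2 := deriv_of_diff (fun q : M => (X1 q).1.1) (f := fun q : M => (X2 q).2.1) (df d2).
  have e3 := deriv_of_diff (fun q : M => (X2 q).1.1) (f := fun q : M => (X1 q).2.1) (df d1).
  by congr pair; rewrite /= ?addr0 ?e1// e2 e3 opprB opprK addrC.
have e2 := deriv_of_diff (fun q : M => (X1 q).1.1) (f := fun q : M => (X2 q).2.2) (dg d2).
have e3 := deriv_of_diff (fun q : M => (X2 q).1.1) (f := fun q : M => (X1 q).2.2) (dg d1).
have e4 := pairing_lie_form z.1 (dv d1) (da d2).
have e5 := pairing_int_ext_deriv (fun q => (X2 q).1.1) z.1 (da d1).
have e6 := pairing_diff_form z.1 (f := fun q : M => (X1 q).2.1) (df d1).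
have e7 := pairing_diff_form z.1 (f := fun q : M => (X1 q).2.2) (dg d1).
rewrite /ev /= e2 e3 (pairingDr z.1 (_ - _)) (pairingDr z.1 (lie_form _ _ _ _)) pairingNr.
rewrite e4 e5 !pairingE e6 e7.
ring.
Qed.

End Bracket.

End LocalForms.

(** * The endomorphisms in a chart *)

Section Local.
Variables (R : realType) (n : nat) (M : topologicalType) (A : atlas 'rV[R]_n M).
Hypothesis hA : smooth_manifold A.
Local Notation E := 'rV[R]_n.
Local Notation T := (tangent A).
Local Notation Td := (cotangent A).

Lemma pairing_cotangent c c' q v a : pairing v (Td c c' q a) = pairing (T c' c q v) a.
Proof. by rewrite /cotangent pairing_transpose//; exact: tangent_linear. Qed.

Lemma cotangentK c c' q : dom A c q -> dom A c' q -> cancel (Td c c' q) (Td c' c q).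
Proof.
by move=> D D' a; apply: pairing_inj => v; rewrite !pairing_cotangent tangentK.
Qed.

Lemma ebundleK c c' q : dom A c q -> dom A c' q ->
  cancel (ebundle A c c' q) (ebundle A c' c q).
Proof.
by move=> D D' [[X a] fg]; rewrite /ebundle /gtangent /= tangentK// cotangentK.
Qed.

Lemma ebundle_id c q : dom A c q -> ebundle A c c q = id.
Proof.
move=> D; apply/funext => -[[X a] fg]; rewrite /ebundle /gtangent /= tangent_id//.
congr (_, _, _); apply: pairing_inj => v.
by rewrite pairing_cotangent tangent_id.
Qed.

Lemma chK_center p : chV A p (ch A p p) = p.
Proof. by rewrite (mfd_chK hA)//; exact: mfd_center. Qed.

Lemma local_map_center (F : normedModType R) (B : frame_change M F) h p w :
  B p p p = id -> local_map A B h p (ch A p p) w = h p w.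
Proof. by move=> e; rewrite /local_map chK_center e. Qed.

Lemma local_section_center (F : normedModType R) (B : frame_change M F) X p :
  B p p p = id -> local_section A B X p (ch A p p) = X p.
Proof. by move=> e; rewrite /local_section chK_center e. Qed.

Lemma near_target p : \forall y \near ch A p p, target A p y.
Proof.
by apply: open_nbhs_nbhs; split; [exact: mfd_target_open | apply: target_ch; exact: mfd_center].
Qed.

Lemma dom_target c y : target A c y -> dom A c (chV A c y).
Proof. by move=> /(targetP hA)[]. Qed.

Section AlmostContact.
Variables (phi : M -> E -> E) (xi : M -> E) (eta : M -> 'cV[R]_n).
Hypothesis hac : almost_contact A phi xi eta.

Lemma phi_linear p : linear (phi p).
Proof. by move=> k u v; have [H _] := ac_phi hac; exact: H. Qed.

Lemma eta_phi p v : pairing (phi p v) (eta p) = 0.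
Proof.
rewrite -pairing_transpose; last exact: phi_linear.
by rewrite (ac_phi_eta hac) pairing0r.
Qed.

(** [P] and [J] as bundle maps, and their expressions in the chart at [c]. *)
Definition acs_map (q : M) := acs_op (phi q) (xi q) (eta q).
Definition gen_map (q : M) := gen_op (phi q) (xi q) (eta q).

Definition acs_loc c y := acs_op (local_map A T phi c y) (local_section A T xi c y)
  (local_section A Td eta c y).
Definition gen_loc c y := gen_op (local_map A T phi c y) (local_section A T xi c y)
  (local_section A Td eta c y).

Lemma local_phi_linear c y : linear (local_map A T phi c y).
Proof.
by move=> k u v; rewrite /local_map (tangent_linear A) phi_linear (tangent_linear A).
Qed.

Lemma acs_map_sqr p v : acs_map p (acs_map p v) = - v.
Proof.
rewrite /acs_map /acs_op /= (linB (phi_linear p)) (linZ (phi_linear p)).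
rewrite (ac_phi2 hac) (ac_phi_xi hac) scaler0 subr0 addrK.
rewrite !pairingE eta_phi (ac_eta_xi hac) add0r mulr1.
by case: v.
Qed.

Lemma acs_loc_apply c y q v : target A c y -> chV A c y = q ->
  acs_loc c y (T q c q v.1, v.2) = (T q c q (acs_map q v).1, (acs_map q v).2).
Proof.
move=> Ty <-; have D := dom_target Ty; have Dq := mfd_center hA (chV A c y).
rewrite /acs_loc /acs_op /local_map /local_section /= tangentK//.
rewrite (linB (@tangent_linear _ _ _ _ _ _ _)) tangentZ.
by rewrite pairing_cotangent tangentK.
Qed.

(** Holds on a neighbourhood and not only at the centre, so that it can be
   differentiated. *)
Lemma acs_loc_sqr c y v : target A c y -> acs_loc c y (acs_loc c y v) = - v.
Proof.
move=> Ty; have D := dom_target Ty; have Dq := mfd_center hA (chV A c y).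
set q := chV A c y in D Dq.
have -> : v = (T q c q (T c q q v.1), v.2) by rewrite tangentK//; case: (v).
rewrite (acs_loc_apply (T c q q v.1, v.2) Ty erefl) (acs_loc_apply _ Ty erefl) acs_map_sqr.
by rewrite /= (linN (@tangent_linear _ _ _ _ _ _ _)).
Qed.

Lemma acs_loc_center p : acs_loc p (ch A p p) = acs_map p.
Proof.
have e : T p p p = id by apply: tangent_id => //; exact: mfd_center.
have e' : Td p p p = id.
  by apply/funext => a; apply: pairing_inj => v; rewrite pairing_cotangent e.
apply/funext => v; rewrite /acs_loc /acs_op !local_map_center// !local_section_center//.
Qed.

Lemma local_map_gen_map c y : local_map A (ebundle A) gen_map c y = gen_loc c y.
Proof.
apply/funext => -[[X a] [f g]]; set q := chV A c y.
rewrite /gen_loc /gen_op /local_map /local_section -/q /gen_map /ebundle /gtangent /gen_op /=.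
rewrite (linD (@tangent_linear _ _ _ _ _ _ _)) tangentZ !pairing_cotangent.
congr (_, _, _); apply: pairing_inj => v.
rewrite pairing_cotangent !pairingE !pairing_cotangent.
rewrite !pairing_transpose ?pairing_cotangent//; last exact: phi_linear.
  exact: tangent_linear.
exact: (@local_phi_linear c y).
Qed.

Lemma local_section_gen_map X c y : target A c y ->
  local_section A (ebundle A) (bapp gen_map X) c y
  = gen_loc c y (local_section A (ebundle A) X c y).
Proof.
move=> Ty; rewrite -local_map_gen_map /local_map /local_section ebundleK//.
- exact: mfd_center.
- exact: dom_target.
Qed.

End AlmostContact.
End Local.

(** * The torsion as a tensor *)

Section Tensor.
Variables (R : realType) (n : nat) (M : topologicalType) (A : atlas 'rV[R]_n M).
Hypothesis hA : smooth_manifold A.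
Local Notation E := 'rV[R]_n.
Local Notation L := ('rV[R]_n * R)%type.
Local Notation T := (tangent A).
Variables (phi : M -> E -> E) (xi : M -> E) (eta : M -> 'cV[R]_n).
Hypothesis hac : almost_contact A phi xi eta.
Local Notation P := (acs_map phi xi eta).
Local Notation J := (gen_map phi xi eta).
Local Notation acs_loc := (acs_loc A phi xi eta).
Local Notation gen_loc := (gen_loc A phi xi eta).

Lemma smooth_gen_loc c x : smooth_on (target A c) (fun y => gen_loc c y x).
Proof.
have oT : open (target A c) by exact: (mfd_target_open hA).
have fv : findim 'rV[R]_n by exact: findim_mx.
have fa : findim 'cV[R]_n by exact: findim_mx.
move=> k; have [_ /(_ c)Sphi] := ac_phi hac.
have Sxi := ac_xi hac c k; have Seta := ac_eta hac c k.
have pl v : linear (fun a : 'cV[R]_n => - pairing v a).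
  by move=> h a b; rewrite !pairingE opprD /GRing.scale /= mulrN.
have pr (a : 'cV[R]_n) : linear (fun v => - pairing v a).
  by move=> h u v; rewrite !pairingE opprD /GRing.scale /= mulrN.
apply: Ck_pair => //; apply: Ck_pair => //=.
- apply: CkD => //; first exact: Sphi.
  by apply: CkZV => //; exact: Ck_cst.
- apply: CkD => //; last by apply: CkZV => //; exact: Ck_cst.
  apply: (@Ck_eq _ _ _ _ _ (fun y => \sum_i
     (- pairing (local_map A T phi c y (delta_mx 0 i)) x.1.2) *: delta_mx i 0)) => //.
    move=> y _; rewrite {1}[transpose _ _]matrix_sum_delta -sumrN.
    apply: eq_bigr => i _; rewrite big_ord1 -pairing_delta.
    by rewrite pairing_transpose ?scaleNr//; exact: (local_phi_linear hac).
  apply: Ck_sum => // i; apply: CkZV => //; last exact: Ck_cst.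
  exact: (Ck_postlin oT (pr _) (findim_continuous fv (pr _)) (Sphi _ k)).
- exact: (Ck_postlin oT (pl _) (findim_continuous fa (pl _)) Seta).
- exact: (Ck_postlin oT (pr _) (findim_continuous fv (pr _)) Sxi).
Qed.

Lemma bundle_morphism_gen_map : bundle_morphism A (ebundle A) J.
Proof.
split => [q k u v|c w].
  by rewrite /gen_map gen_op_linear//; exact: (phi_linear hac).
rewrite (_ : (fun y => _) = fun y => gen_loc c y w); first exact: smooth_gen_loc.
by apply/funext => y; rewrite (local_map_gen_map hac).
Qed.

(** The derivatives of [J] and [P] at [p], in the chart at [p]. *)
Definition gen_deriv p (u : E) (x : efib R n) := 'd (fun y => gen_loc p y x) (ch A p p) u.
Definition acs_deriv p (u : E) (v : L) := 'd (fun y => acs_loc p y v) (ch A p p) u.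

Lemma target_center p : target A p (ch A p p).
Proof. by apply: target_ch; exact: mfd_center. Qed.

Lemma is_diff_gen_loc p x : is_diff (ch A p p) (fun y => gen_loc p y x) (gen_deriv p ^~ x).
Proof. exact: (Ck_is_diff (smooth_gen_loc p x 1%N) (target_center p)). Qed.

Lemma is_diff_acs_loc_vec p x :
  is_diff (ch A p p) (fun y => acs_loc p y (vec x)) (fun u => vec (gen_deriv p u x)).
Proof.
apply: is_diff_near (is_diff_comp (is_diff_gen_loc p x)
   (is_diff_findim _ (findim_efib R n) (@vec_linear R n))).
by near=> y; rewrite /= vec_gen_op//; exact: (local_phi_linear hac).
Unshelve. all: by end_near. Qed.

Lemma is_diff_acs_loc p v : is_diff (ch A p p) (fun y => acs_loc p y v) (acs_deriv p ^~ v).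
Proof.
have -> : v = vec (n := n) ((v.1, 0), (- v.2, 0)) by rewrite /vec /= opprK; case: v.
by apply: differentiableP; have [] := is_diff_acs_loc_vec p ((v.1, 0), (- v.2, 0)).
Qed.

Lemma vec_gen_deriv p u x : vec (gen_deriv p u x) = acs_deriv p u (vec x).
Proof.
have [_ e] := is_diff_acs_loc_vec p x.
by rewrite -[LHS](congr1 (fun f => f u) e).
Qed.

Lemma ev_gen_deriv p u z x : ev z (covec (gen_deriv p u x)) = - ev (acs_deriv p u z) (covec x).
Proof.
have l1 := ev_covec_linear (n := n) z.
have l2 : linear (fun v => - ev v (covec x)).
  by move=> k v w; rewrite /ev /= !pairingE /GRing.scale /=; ring.
have [_ e1] := is_diff_comp (is_diff_gen_loc p x) (is_diff_findim _ (findim_efib R n) l1).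
have [_ e2] := is_diff_comp (is_diff_acs_loc p z) (is_diff_findim _ (findim_line R n) l2).
rewrite -[LHS](congr1 (fun f => f u) e1) -[RHS](congr1 (fun f => f u) e2).
congr ('d _ _ _); apply/funext => y /=.
by rewrite ev_gen_op//; exact: (local_phi_linear hac).
Qed.

(** Derivative of [P^2 = -1]. *)
Lemma acs_deriv_anticomm p u v : acs_deriv p u (P p v) = - P p (acs_deriv p u v).
Proof.
have lP : \forall y \near ch A p p, linear (acs_loc p y).
  by near=> y; apply: acs_op_linear; exact: (local_phi_linear hac).
have D := is_diff_apply (findim_line R n) lP (is_diff_acs_loc p) (is_diff_acs_loc p v).
have [_ e1] : is_diff (ch A p p) (fun=> - v)
   (fun u => acs_deriv p u (acs_loc p (ch A p p) v) + acs_loc p (ch A p p) (acs_deriv p u v)).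
  apply: is_diff_near D; have H := near_target hA p.
  by near=> y; rewrite (acs_loc_sqr hA hac)//; near: y.
apply/eqP; rewrite -addr_eq0; apply/eqP.
have := congr1 (fun f => f u) e1; rewrite !(acs_loc_center hA) => <-.
by have [_ ->] := is_diff_cst (- v) (ch A p p).
Unshelve. all: by end_near. Qed.

(** The tensor whose vanishing is equivalent to both integrability conditions.
   Sections of [TM + R] over [M] are the vector fields on [M x R] that do not depend
   on the coordinate of the line, and [P] does not depend on it either: only the
   component [u.1] along [M] differentiates. *)
Definition torsion_at p (v w : L) := torsion (P p) (fun u => acs_deriv p u.1) v w.

End Tensor.

(** * Integrability on the generalized tangent bundle *)

Section Sides.
Variables (R : realType) (n : nat) (M : topologicalType) (A : atlas 'rV[R]_n M).
Hypothesis hA : smooth_manifold A.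
Local Notation E := 'rV[R]_n.
Local Notation L := ('rV[R]_n * R)%type.
Local Notation T := (tangent A).
Variables (phi : M -> E -> E) (xi : M -> E) (eta : M -> 'cV[R]_n).
Hypothesis hac : almost_contact A phi xi eta.
Local Notation P := (acs_map phi xi eta).
Local Notation J := (gen_map phi xi eta).
Local Notation acs_loc := (acs_loc A phi xi eta).
Local Notation gen_loc := (gen_loc A phi xi eta).
Local Notation acs_deriv := (acs_deriv A phi xi eta).
Local Notation gen_deriv := (gen_deriv A phi xi eta).
Local Notation torsion_at := (torsion_at A phi xi eta).

Lemma smooth_section_diff (F : normedModType R) (B : frame_change M F) X p :
  smooth_section A B X ->
  is_diff (ch A p p) (local_section A B X p) ('d (local_section A B X p) (ch A p p)).
Proof. by move=> /(_ p 1%N) H; apply: (Ck_is_diff H); exact: target_center. Qed.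

Lemma gen_loc_center p x : gen_loc p (ch A p p) x = J p x.
Proof.
rewrite -(local_map_gen_map hac) (local_map_center hA)// (ebundle_id hA)//.
exact: (mfd_center hA).
Qed.

Lemma is_diff_gen_map X p (DX : E -> efib R n) :
  is_diff (ch A p p) (local_section A (ebundle A) X p) DX ->
  is_diff (ch A p p) (local_section A (ebundle A) (bapp J X) p)
    (fun u => gen_deriv p u (X p) + J p (DX u)).
Proof.
move=> dX; have lJ : \forall y \near ch A p p, linear (gen_loc p y).
  by near=> y; apply: gen_op_linear; exact: (local_phi_linear hac).
have := is_diff_apply (findim_efib R n) lJ (is_diff_gen_loc hA hac p) dX.
rewrite (local_section_center hA); last first.
  by rewrite (ebundle_id hA)//; exact: (mfd_center hA).
have -> : (fun u => gen_deriv p u (X p) + gen_loc p (ch A p p) (DX u))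
   = (fun u => gen_deriv p u (X p) + J p (DX u)).
  by apply/funext => u; rewrite gen_loc_center.
apply: is_diff_near; have H := near_target hA p.
by near=> y; rewrite (local_section_gen_map hA hac)//; near: y.
Unshelve. all: by end_near. Qed.

Lemma acs_map_linear p : linear (P p).
Proof. by apply: acs_op_linear; exact: (phi_linear hac). Qed.

Lemma vec_gen_map p x : vec (J p x) = P p (vec x).
Proof. by rewrite vec_gen_op//; exact: (phi_linear hac). Qed.

Lemma ev_gen_map p z x : ev z (covec (J p x)) = - ev (P p z) (covec x).
Proof. by rewrite ev_gen_op//; exact: (phi_linear hac). Qed.

Section Jets.
Variables (p : M) (x y bJJ b bJ b' : efib R n) (DX DY DJX DJY : E -> efib R n).
Hypotheses (eDJX : forall u, DJX u = gen_deriv p u x + J p (DX u))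
  (eDJY : forall u, DJY u = gen_deriv p u y + J p (DY u)).
Hypotheses (hJJ : bracket_of_jets (J p x) (J p y) DJX DJY bJJ)
  (h : bracket_of_jets x y DX DY b)
  (hJ : bracket_of_jets (J p x) y DJX DY bJ)
  (h' : bracket_of_jets x (J p y) DX DJY b').

Let vDJX u : vec (DJX u) = acs_deriv p u (vec x) + P p (vec (DX u)).
Proof. by rewrite eDJX (linD (@vec_linear R n)) (vec_gen_deriv hA hac) vec_gen_map. Qed.

Let vDJY u : vec (DJY u) = acs_deriv p u (vec y) + P p (vec (DY u)).
Proof. by rewrite eDJY (linD (@vec_linear R n)) (vec_gen_deriv hA hac) vec_gen_map. Qed.

Lemma vec_gen_nijenhuis : vec (bJJ - b - J p (bJ + b')) = torsion_at p (vec x) (vec y).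
Proof.
have vl := @vec_linear R n.
rewrite !(linB vl) vec_gen_map (linD vl) hJJ.1 h.1 hJ.1 h'.1 !vDJX !vDJY !vec_gen_map.
exact: (nijenhuis_vec (fun u => acs_deriv p u.1) (acs_map_linear p) (acs_map_sqr hac p)
  (vec x) (vec y) (fun u => vec (DX u.1)) (fun u => vec (DY u.1))).
Qed.

Lemma ev_gen_nijenhuis z : ev z (covec (bJJ - b - J p (bJ + b'))) =
  ev (torsion_at p z (vec x)) (covec y) + ev (torsion_at p (vec y) z) (covec x).
Proof.
have el w := @ev_covec_linear R n w.
rewrite !(linB (el z)) ev_gen_map (linD (el _)) opprK hJJ.2 h.2 hJ.2 h'.2.
rewrite !vDJX !vec_gen_map.
rewrite -(nijenhuis_covec (acs_map_linear p) (acs_map_sqr hac p) (vec x) (vec y) z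
  (Ja := covec (J p x)) (Jb := covec (J p y))
  (fun u => vec (DX u.1)) (fun u => vec (DY u.1))
  (Da := fun u => covec (DX u.1)) (Db := fun u => covec (DY u.1))
  (DJa := fun u => covec (DJX u.1)) (DJb := fun u => covec (DJY u.1)))//.
- by move=> u v; exact: acs_deriv_anticomm.
- by move=> w; rewrite ev_gen_map.
- by move=> w; rewrite ev_gen_map.
- by move=> u w; rewrite eDJX (linD (el _)) (ev_gen_deriv hA hac) ev_gen_map.
- by move=> u w; rewrite eDJY (linD (el _)) (ev_gen_deriv hA hac) ev_gen_map.
Qed.

End Jets.

(** The vector component of the torsion of [J] is [torsion_at]; its covector component is a
   combination of contractions of [torsion_at], which vanish with it. *)
Lemma gen_integrableP : integrable_for (smooth_section A (ebundle A)) (ebracket A) J <->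
  forall p v w, torsion_at p v w = 0.
Proof.
split=> [H p v w|H X Y sX sY p].
  have section_through (u : L) : exists2 X, smooth_section A (ebundle A) X & vec (X p) = u.
    have [Z sZ Zp] := vector_field_through hA p u.1.
    exists (fun q => ((Z q, 0), (- u.2, 0))); last first.
      by rewrite /vec /= Zp opprK; case: (u).
    move=> c k; have oT : open (target A c) by exact: (mfd_target_open hA).
    apply: (@Ck_eq _ _ _ _ _ (fun y => ((local_section A T Z c y, 0), (- u.2, 0)))) => //.
      move=> y _; rewrite /local_section /ebundle /gtangent /=; congr (_, _, _).
      by apply: pairing_inj => t; rewrite pairing_cotangent !pairing0r.
    apply: Ck_pair => //; last exact: Ck_cst.
    by apply: Ck_pair => //; [exact: sZ|exact: Ck_cst].
  have [X sX <-] := section_through v; have [Y sY <-] := section_through w.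
  have dX := smooth_section_diff p sX; have dY := smooth_section_diff p sY.
  have dJX := is_diff_gen_map dX; have dJY := is_diff_gen_map dY.
  rewrite -(vec_gen_nijenhuis (fun=> erefl) (fun=> erefl) (ebracketP dJX dJY)
    (ebracketP dX dY) (ebracketP dJX dY) (ebracketP dX dJY)).
  by have -> := H X Y sX sY p; congr pair; rewrite /= oppr0.
have dX := smooth_section_diff p sX; have dY := smooth_section_diff p sY.
have dJX := is_diff_gen_map dX; have dJY := is_diff_gen_map dY.
apply: efib_eq0 => [|z].
  rewrite -(H p (vec (X p)) (vec (Y p))).
  exact: (vec_gen_nijenhuis (fun=> erefl) (fun=> erefl) (ebracketP dJX dJY)
    (ebracketP dX dY) (ebracketP dJX dY) (ebracketP dX dJY)).
have := ev_gen_nijenhuis (fun=> erefl) (fun=> erefl) (ebracketP dJX dJY)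
    (ebracketP dX dY) (ebracketP dJX dY) (ebracketP dX dJY) z.
rewrite !H => ->.
by rewrite /ev /= !pairing0l !mul0r !addr0.
Qed.

End Sides.

(** * Integrability on the product with a line *)

Section ProductLine.
Variables (R : realType) (n : nat) (M : topologicalType) (A : atlas 'rV[R]_n M).
Hypothesis hA : smooth_manifold A.
Local Notation E := 'rV[R]_n.
Local Notation L := ('rV[R]_n * R)%type.
Local Notation T := (tangent A).
Local Notation B := (prod_line A).

Lemma target_prod_line c : target B c = [set y | target A c.1 y.1].
Proof.
apply/seteqP; split => [_ [q Dq <-]|y [q Dq e]]; first exact: target_ch.
by exists (q, y.2) => //; rewrite /= e; case: (y).
Qed.

Lemma open_target_prod_line c : open (target B c).
Proof.
rewrite target_prod_line; apply: (@open_comp _ _ (fst : L -> E)).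
  by move=> y _; exact: cvg_fst.
exact: (mfd_target_open hA).
Qed.

Lemma tangent_prod_line c c' q s v : dom A c.1 q -> dom A c'.1 q ->
  tangent B c c' (q, s) v = (T c.1 c'.1 q v.1, v.2).
Proof.
move=> D D'; have dT := is_diff_transition hA D D'.
have d1 := is_diff_fst (is_diff_id (ch A c.1 q, s)).
have d2 := is_diff_snd (is_diff_id (ch A c.1 q, s)).
have [_ e] := is_diff_pair (is_diff_comp d1 dT) d2.
exact: (congr1 (fun f => f v) e).
Qed.

Lemma local_section_prod_line X c y : target B c y ->
  let q := chV A c.1 y.1 in
  local_section B (tangent B) X c y = (T q c.1 q (X (q, y.2)).1, (X (q, y.2)).2).
Proof.
rewrite target_prod_line => Ty q; rewrite /local_section tangent_prod_line//.
  exact: (mfd_center hA).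
exact: (dom_target hA).
Qed.

Section Contact.
Variables (phi : M -> E -> E) (xi : M -> E) (eta : M -> 'cV[R]_n).
Hypothesis hac : almost_contact A phi xi eta.
Local Notation P := (acs_map phi xi eta).
Local Notation PB := (product_acs phi xi eta).
Local Notation acs_loc := (acs_loc A phi xi eta).
Local Notation acs_deriv := (acs_deriv A phi xi eta).
Local Notation torsion_at := (torsion_at A phi xi eta).

Lemma center_prod_line c : target B c (ch B c c).
Proof. by exists c => //; exact: (mfd_center hA). Qed.

Lemma near_target_prod_line c : \forall y \near ch B c c, target B c y.
Proof.
apply: open_nbhs_nbhs; split; [exact: open_target_prod_line|exact: center_prod_line].
Qed.

Lemma local_section_prod_line_center X c :
  local_section B (tangent B) X c (ch B c c) = X c.
Proof.
rewrite local_section_prod_line; last exact: center_prod_line.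
rewrite /= (chK_center hA) (tangent_id hA); last exact: (mfd_center hA).
by case: c => q s /=; case: (X _).
Qed.

Lemma local_section_product_acs X c y : target B c y ->
  local_section B (tangent B) (bapp PB X) c y
  = acs_loc c.1 y.1 (local_section B (tangent B) X c y).
Proof.
move=> Ty; rewrite !local_section_prod_line//.
have Ty' : target A c.1 y.1 by move: Ty; rewrite target_prod_line.
by rewrite (acs_loc_apply hA phi xi eta _ Ty' erefl).
Qed.

Lemma is_diff_product_acs X c (DX : L -> L) :
  is_diff (ch B c c) (local_section B (tangent B) X c) DX ->
  is_diff (ch B c c) (local_section B (tangent B) (bapp PB X) c)
    (fun u => acs_deriv c.1 u.1 (X c) + P c.1 (DX u)).
Proof.
move=> dX.
have lP : \forall y \near ch B c c, linear (acs_loc c.1 y.1).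
  by near=> y; apply: acs_op_linear; exact: (local_phi_linear hac).
have dP w : is_diff (ch B c c) (fun y : L => acs_loc c.1 y.1 w) (fun u => acs_deriv c.1 u.1 w).
  have d1 := is_diff_fst (is_diff_id (ch B c c)).
  exact: (is_diff_comp d1 (is_diff_acs_loc hA hac c.1 w)).
have D := is_diff_apply (findim_line R n) lP dP dX.
have -> : (fun u => acs_deriv c.1 u.1 (X c) + P c.1 (DX u)) = (fun u =>
    acs_deriv c.1 u.1 (local_section B (tangent B) X c (ch B c c))
    + acs_loc c.1 (ch B c c).1 (DX u)).
  by apply/funext => u; rewrite local_section_prod_line_center (acs_loc_center hA).
apply: is_diff_near D; have H := near_target_prod_line c.
by near=> y; rewrite local_section_product_acs//; near: y.
Unshelve. all: by end_near. Qed.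

Lemma nijenhuis_product_acs X Y c : vector_field B X -> vector_field B Y ->
  lie B (bapp PB X) (bapp PB Y) c - lie B X Y c
    - PB c (lie B (bapp PB X) Y c + lie B X (bapp PB Y) c)
  = torsion_at c.1 (X c) (Y c).
Proof.
move=> sX sY.
have dX := Ck_is_diff (sX c 1%N) (center_prod_line c).
have dY := Ck_is_diff (sY c 1%N) (center_prod_line c).
have dPX := is_diff_product_acs dX; have dPY := is_diff_product_acs dY.
have e1 := lie_of_diff dPX dPY; have e2 := lie_of_diff dX dY.
have e3 := lie_of_diff dPX dY; have e4 := lie_of_diff dX dPY.
have F (b1 b2 b3 b4 b1' b2' b3' b4' : L) : b1 = b1' -> b2 = b2' -> b3 = b3' ->
    b4 = b4' -> b1 - b2 - PB c (b3 + b4) = b1' - b2' - P c.1 (b3' + b4').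
  by move=> -> -> -> ->.
apply: (etrans (F _ _ _ _ _ _ _ _ e1 e2 e3 e4)).
exact: (nijenhuis_vec (fun u => acs_deriv c.1 u.1) (acs_map_linear hac c.1)
  (acs_map_sqr hac c.1) (X c) (Y c)
  ('d (local_section B (tangent B) X c) (ch B c c))
  ('d (local_section B (tangent B) Y c) (ch B c c))).
Qed.

(** The torsion at [(p, s)] only depends on the values of the two fields, hence
   no loss occurs in testing it on fields that are invariant along the line. *)
Lemma product_integrableP : integrable_acs B PB <->
  forall p v w, torsion_at p v w = 0.
Proof.
split=> [H p v w|H X Y sX sY c]; last first.
  exact: (etrans (nijenhuis_product_acs c sX sY) (H _ _ _)).
have field_through (u : L) : exists2 X, vector_field B X & X (p, 0) = u.
  have [Z sZ Zp] := vector_field_through hA p u.1.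
  exists (fun q => (Z q.1, u.2)); last by rewrite /= Zp; case: (u).
  move=> c k; have oT : open (target B c) by exact: open_target_prod_line.
  apply: (@Ck_eq _ _ _ _ _ (fun y => (local_section A T Z c.1 y.1, u.2))) => //.
    by move=> y Ty; rewrite local_section_prod_line.
  apply: Ck_pair => //; last exact: Ck_cst.
  apply: (Ck_prelin (B := target A c.1) (l := fst)) => //; last exact: sZ.
    by move=> y; exact: cvg_fst.
  by move=> y; rewrite target_prod_line.
have [X sX <-] := field_through v; have [Y sY <-] := field_through w.
exact: (etrans (esym (nijenhuis_product_acs (p, 0) sX sY)) (H X Y sX sY (p, 0))).
Qed.

End Contact.
End ProductLine.

(** * The generalized almost contact triple *)

Section Triple.
Variables (R : realType) (n : nat) (M : topologicalType) (A : atlas 'rV[R]_n M).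
Hypothesis hA : smooth_manifold A.
Local Notation E := 'rV[R]_n.
Variables (phi : M -> E -> E) (xi : M -> E) (eta : M -> 'cV[R]_n).
Hypothesis hac : almost_contact A phi xi eta.
Local Notation Phi := (assoc_Phi phi).
Local Notation e1 := (assoc_e1 xi).
Local Notation e2 := (assoc_e2 eta).
Local Notation J := (gen_map phi xi eta).

Let phi0 p : phi p 0 = 0.
Proof. by have := linZ (phi_linear hac p) 0 0; rewrite !scale0r. Qed.

Let transpose0 p : transpose (phi p) 0 = 0.
Proof. by rewrite /transpose mulmx0. Qed.

Lemma JmapE p X a f g : J p ((X, a), (f, g)) =
  ((phi p X + f *: xi p, - transpose (phi p) a + g *: eta p),
   (- pairing X (eta p), - pairing (xi p) a)).
Proof. by []. Qed.

Lemma gen_map_Phi p x : (J p (x, (0, 0))).1 = Phi p x.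
Proof. by case: x => X a; rewrite JmapE !scale0r !addr0. Qed.

Lemma emetricE (x y : efib R n) :
  emetric x y = 2^-1 * (ev (vec y) (covec x) + ev (vec x) (covec y)).
Proof. by rewrite /emetric /gmetric /ev /=; ring. Qed.

Lemma gen_map_sqr p x : J p (J p x) = - x.
Proof.
have vl := @vec_linear R n; have el w := @ev_covec_linear R n w.
apply/subr0_eq/efib_eq0 => [|z].
  by rewrite (linB vl) (linN vl) !(vec_gen_map hac) (acs_map_sqr hac) subrr.
rewrite (linB (el z)) (linN (el z)) !(ev_gen_map hac) (acs_map_sqr hac) evNl opprK.
by rewrite subrr.
Qed.

Lemma gen_map_skew p x y : emetric (J p x) y = - emetric x (J p y).
Proof. by rewrite !emetricE !(vec_gen_map hac) !(ev_gen_map hac); ring. Qed.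

Lemma gmetric_e1 p x : 2 * gmetric x (e1 p) = pairing (xi p) x.2.
Proof. by rewrite /gmetric /= pairing0r addr0 mulrA mulfV ?mul1r// pnatr_eq0. Qed.

Lemma gmetric_e2 p x : 2 * gmetric x (e2 p) = pairing x.1 (eta p).
Proof. by rewrite /gmetric /= pairing0l add0r mulrA mulfV ?mul1r// pnatr_eq0. Qed.

Lemma associated_gen_map : associated_J A Phi e1 e2 J.
Proof.
split.
- exact: bundle_morphism_gen_map.
- exact: gen_map_sqr.
- exact: gen_map_skew.
- move=> p; rewrite JmapE phi0 transpose0 !pairingE.
  by rewrite scale1r scale0r !addr0 add0r !oppr0.
- move=> p; rewrite JmapE phi0 transpose0 !pairingE.
  by rewrite scale1r scale0r !addr0 !oppr0 add0r.
- move=> p; rewrite JmapE (ac_phi_xi hac) transpose0 (ac_eta_xi hac) !pairingE.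
  by rewrite !scale0r !addr0 !oppr0.
- move=> p; rewrite JmapE phi0 (ac_phi_eta hac) (ac_eta_xi hac) !pairingE.
  by rewrite !scale0r !addr0 !oppr0.
- move=> p [X a] g1 g2; apply: (congr2 pair); first exact: gen_map_Phi.
  have := gmetric_e1 p (X, a); have := gmetric_e2 p (X, a).
  by rewrite g1 g2 mulr0 /= => <- <-; rewrite oppr0.
Qed.

(** A vector [x] of [TM + T*M] splits as [x' + 2<x,e2> e1 + 2<x,e1> e2] with [x']
   orthogonal to [e1] and [e2], so that linearity and the prescribed values
   determine [J]. *)
Lemma associated_J_unique J' : associated_J A Phi e1 e2 J' -> J' = J.
Proof.
move=> HJ; apply/funext => p; apply/funext => -[[X a] [f g]].
have Jl : linear (J' p) by move=> k u v; exact: (aJ_morphism HJ).1.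
set s := pairing X (eta p); set t := pairing (xi p) a.
pose x' : gfib R n := (X - s *: xi p, a - t *: eta p).
have -> : ((X, a), (f, g)) = (x', (0, 0)) + s *: (e1 p, (0, 0)) + t *: (e2 p, (0, 0))
    + f *: (0, (1, 0)) + g *: (0, (0, 1)) :> efib R n.
  apply: (congr2 pair); apply: (congr2 pair).
  - by rewrite /= !scaler0 !addr0 subrK.
  - by rewrite /= !scaler0 !addr0 subrK.
  - by rewrite /= /GRing.scale /= !mulr0 mulr1 !addr0 !add0r.
  - by rewrite /= /GRing.scale /= !mulr0 mulr1 !addr0 !add0r.
have x1 : gmetric x' (e1 p) = 0.
  by rewrite /gmetric /= !pairingE (ac_eta_xi hac) -/t; ring.
have x2 : gmetric x' (e2 p) = 0.
  by rewrite /gmetric /= !pairingE (ac_eta_xi hac) -/s; ring.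
have Jl' : linear (J p) by move=> k u v; exact: (aJ_morphism associated_gen_map).1.
rewrite !(linD Jl) !(linZ Jl) !(linD Jl') !(linZ Jl').
rewrite (aJ_perp HJ x1 x2) (aJ_e1 HJ) (aJ_e2 HJ) (aJ_vt HJ) (aJ_dt HJ).
rewrite (aJ_perp associated_gen_map x1 x2) (aJ_e1 associated_gen_map).
by rewrite (aJ_e2 associated_gen_map) (aJ_vt associated_gen_map) (aJ_dt associated_gen_map).
Qed.

(** [Phi] is a block of [J], and inherits its smoothness. *)
Lemma bundle_morphism_Phi : bundle_morphism A (gtangent A) Phi.
Proof.
have [Jl Js] := bundle_morphism_gen_map hA hac; split=> [q k u v|c w].
  rewrite -!gen_map_Phi (_ : (_, _) = k *: (u, (0, 0)) + (v, (0, 0)) :> efib R n).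
    by rewrite Jl.
  by congr (_, (_, _)); rewrite /= scaler0 addr0.
have Js' := Js c (w, (0, 0)); move=> k.
have l : linear (fst : efib R n -> gfib R n) by [].
have lc : continuous (fst : efib R n -> gfib R n) by move=> ?; exact: cvg_fst.
have := Ck_postlin (mfd_target_open hA c) l lc (Js' k).
rewrite (_ : (fun y => _) = (fun y => local_map A (gtangent A) Phi c y w))//.
by apply/funext => y; rewrite /local_map -gen_map_Phi.
Qed.

Lemma gen_almost_contact_assoc : gen_almost_contact A Phi e1 e2.
Proof.
have cot0 c c' q : cotangent A c c' q 0 = 0 by rewrite /cotangent /transpose mulmx0.
split.
- exact: bundle_morphism_Phi.
- move=> c k; have oT := mfd_target_open hA c.
  apply: (@Ck_eq _ _ _ _ _ (fun y => (local_section A (tangent A) xi c y, 0))) => //.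
    by move=> y _; rewrite /local_section /gtangent /= cot0.
  by apply: Ck_pair => //; [exact: (ac_xi hac)|exact: Ck_cst].
- move=> c k; have oT := mfd_target_open hA c.
  apply: (@Ck_eq _ _ _ _ _ (fun y => (0, local_section A (cotangent A) eta c y))) => //.
    by move=> y _; rewrite /local_section /gtangent /= tangent0.
  by apply: Ck_pair => //; [exact: Ck_cst|exact: (ac_eta hac)].
- by move=> p; rewrite /gmetric /= !pairing0r addr0 mulr0.
- by move=> p; rewrite /gmetric /= !pairing0l addr0 mulr0.
- by move=> p; rewrite /gmetric /= pairing0r add0r (ac_eta_xi hac) mulr1.
- move=> p x y; rewrite /gmetric /= !pairingE !pairing_transpose; try exact: (phi_linear hac).
  ring.
- by move=> p; congr pair; rewrite /= ?(ac_phi_xi hac)// transpose0 oppr0.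
- by move=> p; congr pair; rewrite /= ?phi0// (ac_phi_eta hac) oppr0.
- move=> p [X a]; rewrite gmetric_e1 gmetric_e2; congr pair; rewrite /=.
    by rewrite (ac_phi2 hac) scaler0 addr0.
  have pl := phi_linear hac p.
  apply: pairing_inj => v; rewrite !(pairingNr, pairing_transpose)//.
  rewrite opprK (ac_phi2 hac) !pairingE; ring.
Qed.

End Triple.

Theorem proposition25 (R : realType) (n : nat) (hn : odd n)
    (M : topologicalType) (A : atlas 'rV[R]_n M) (hA : smooth_manifold A)
    (phi : M -> 'rV[R]_n -> 'rV[R]_n) (xi : M -> 'rV[R]_n)
    (eta : M -> 'cV[R]_n) (hac : almost_contact A phi xi eta) :
  gen_normal A (assoc_Phi phi) (assoc_e1 xi) (assoc_e2 eta) <->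
  normal_almost_contact A phi xi eta.
Proof.
split=> [[_ [J [HJ iJ]]]|[_ iP]].
  split=> //; apply/(product_integrableP hA hac)/(gen_integrableP hA hac).
  by rewrite -(associated_J_unique hA hac HJ).
split; first exact: gen_almost_contact_assoc.
exists (gen_map phi xi eta); split; first exact: associated_gen_map.
exact/(gen_integrableP hA hac)/(product_integrableP hA hac).
Qed.
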